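(* Let $m$ be a positive integer. Then there exists a constant $c>0$ such that for every nondecreasing function $\omega:(0,\infty)\to(0,\infty)$ satisfying $$\lim_{x\to0}\omega(x)=0\quad\text{and}\quad\omega(2x)\le2^m\omega(x)\ \text{ for } x>0,$$ for every $f\in\Lambda_{\omega,m}$, and for an arbitrary unitary operator $U$ and an arbitrary bounded self-adjoint operator $A$ on Hilbert space, the following inequality holds: $$\left\|\sum_{k=0}^m(-1)^k\binom mk f\big(e^{ikA}U\big)\right\|\le c\,\|f\|_{\Lambda_{\omega,m}}\,\omega_{*,m}\big(\|A\|\big).$$
   Context: Let $\mathbb T$ be the unit circle. For $\tau\in\mathbb T$ put $(\Delta_\tau f)(\zeta)=f(\tau\zeta)-f(\zeta)$, $\zeta\in\mathbb T$, and let $\Delta_\tau^m$ be its $m$-th power. $\Lambda_{\omega,m}$ is the space of continuous functions $f$ on $\mathbb T$ such that $$\|f\|_{\Lambda_{\omega,m}}=\sup_{\tau\ne1,\;\zeta\in\mathbb T}\frac{|(\Delta_\tau^mf)(\zeta)|}{\omega(|1-\tau|)}<\infty .$$ For $x>0$, $\omega_{*,m}(x)=x^m\int_x^\infty\frac{\omega(t)}{t^{m+1}}\,dt$ (possibly $+\infty$), and $\omega_{*,m}(0)=0$. *)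

(* Defs.v *)
From HB Require Import structures.
From mathcomp Require Export all_boot all_order all_algebra.
From mathcomp Require Export complex.
From mathcomp Require Export all_classical all_reals all_analysis.

Set Implicit Arguments.
Unset Strict Implicit.
Unset Printing Implicit Defensive.

Import Order.TTheory GRing.Theory Num.Theory.
Import numFieldNormedType.Exports.

Local Open Scope classical_set_scope.
Local Open Scope ring_scope.

(* Packaging [R[i]] as a [numClosedFieldType] gives it the norm topology that
   the library attaches to such fields. *)
Definition Cplx (R : realType) : numClosedFieldType := R[i].

(* [`|x|] lives in [Cplx R] and has zero imaginary part; [rnorm x] is the same
   number in [R]. *)
Definition rnorm (R : realType) (V : normedModType (Cplx R)) (x : V) : R :=
  complex.Re `|x|.

Section Circle.
Variable R : realType.
Local Notation C := (Cplx R).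
Implicit Types (f : C -> C) (w : R -> R) (m : nat).

Definition circle : set C := [set z | `|z| = 1].

Definition Delta (tau : C) f : C -> C := fun zeta => f (tau * zeta) - f zeta.

Definition Lambda_norm w m f : \bar R :=
  ereal_sup [set e | exists tau zeta : C,
    [/\ circle tau, tau != 1, circle zeta &
      e = (rnorm (iter m (Delta tau) f zeta) / w (rnorm (1 - tau)))%:E]].

(* Functions on the circle are represented by functions on the plane, of which
   only the values on the circle are used. *)
Definition in_Lambda w m f : Prop :=
  {within circle, continuous f} /\ (Lambda_norm w m f < +oo)%E.

Definition omega_star w m (x : R) : \bar R :=
  if x == 0 then 0%E
  else ((x ^+ m)%:E *
    \int[lebesgue_measure]_(t in `[x, +oo[) (w t / t ^+ m.+1)%:E)%E.

End Circle.

Section Operators.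
Variable R : realType.
Local Notation C := (Cplx R).
Variables (H : completeNormedModType C) (dot : {dot H for Num.conj}).
Implicit Types T S V B : H -> H.

Definition opnorm T : \bar R :=
  ereal_sup [set (rnorm (T x))%:E | x in [set x : H | `|x| <= 1]].

Definition is_adjoint T S : Prop := forall x y, dot (T x) y = dot x (S y).

Definition self_adjoint T : Prop := is_adjoint T T.

Definition unitary T : Prop :=
  exists S, [/\ is_adjoint T S, cancel T S & cancel S T].

(* An adjoint is unique when it exists, and unitary operators have one. *)
Definition adjoint T : H -> H := xget (fun=> 0) [set S | is_adjoint T S].

(* For bounded [T] the exponential series converges in operator norm, so its
   sum can be computed pointwise. *)
Definition expop T : H -> H := fun x =>
  limn (series (fun n => (n`!%:R : C)^-1 *: iter n T x)).

(* The general trigonometric polynomial, as [z^* = z^-1] on the circle, and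
   its value at a unitary operator [V], whose inverse is its adjoint. *)
Definition trig_poly (a b : nat -> C) (N : nat) (z : C) : C :=
  \sum_(n < N) (a n * z ^+ n + b n * (z^*)%R ^+ n).

Definition trig_op (a b : nat -> C) (N : nat) V : H -> H :=
  fun x => \sum_(n < N) (a n *: iter n V x + b n *: iter n (adjoint V) x).

(* [opnorm] only looks at the unit ball, hence the linearity requirement.
   [B] is the limit in operator norm of [p_j(V)] for trigonometric polynomials
   [p_j] converging to [f] uniformly on the circle. *)
Definition is_fcalc (f : C -> C) V B : Prop :=
  linear B /\
  forall e : R, 0 < e -> exists (a b : nat -> C) (N : nat),
    (forall z, circle z -> rnorm (f z - trig_poly a b N z) <= e) /\
    (opnorm (fun x => B x - trig_op a b N V x)%R <= e%:E)%E.

(* Continuous functional calculus: for unitary [V] and [f] continuous on the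
   circle there is exactly one [B] with [is_fcalc f V B]. *)
Definition fcalc (f : C -> C) V : H -> H :=
  xget (fun=> 0) [set B | is_fcalc f V B].

End Operators.

(* Main.v *)
From HB Require Import structures.
Require Import Defs.
From mathcomp Require Import cyclic separable cyclotomic measurable_realfun.
From mathcomp Require Import ring lra zify.
Set Implicit Arguments.
Unset Strict Implicit.
Unset Printing Implicit Defensive.
Import Order.TTheory GRing.Theory Num.Theory.
Import numFieldNormedType.Exports.
Local Open Scope classical_set_scope.
Local Open Scope ring_scope.

(* Write [V_t = e^(itA/2) U] for real [t].  For a trigonometric polynomial [g] of
   degree [D] with [|g| <= M], the function [t |-> g(V_t) x] is bounded by
   [M |x|] (von Neumann's inequality) and has exponential type at most
   [D |A| / 2], so a Bernstein inequality bounds its [m]-th difference, which is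
   [sum_k (-1)^k C(m,k) g(e^(ikA) U) x] up to sign, by [(c D |A|)^m M |x|].
   Jackson kernels of degree [O(2^j)] give trigonometric polynomials [h_j]
   within [O(|f|_Lambda w(2^-j))] of [f].  The bound above is applied to each
   [h_(j+1) - h_j] with [j < n], where [2^-n] is about [|A|], and the trivial
   bound [2^m sup] to [f - h_n].  The resulting sum of [2^(jm) |A|^m w(2^-j)] is a
   lower sum for the integral that defines [omega_star].

   The Bernstein inequality is needed with an arbitrary constant only.  Instead
   of interpolation formulas we invert [sinh 3x = 3 sinh x + 4 (sinh x)^3] by
   fixed point iteration, which is a contraction on functions with small
   differences, and descend through the steps [3^j]. *)

(** * Norms and the Bernstein inequality *)

(** [A] and [U] need not commute, so [e^(itA/2) U] is not a one-parameter group and its powers are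
    not exponentials. Each power applied to [x] is instead a vector-valued function of [t], whose
    type grows by a fixed amount with every factor; type is measured by unit differences, so
    derivatives never occur. The half in [A/2] comes from central differences, whose nodes are two
    apart: node [2k] then carries [e^(ikA)].

    The polynomial estimates are not run on [f] itself. One Laurent polynomial [g], within [eta] of
    [f] on the circle, is fixed beforehand, and every [h_j] is obtained from [g] by multiplying its
    coefficients. All objects are then finite sums, and averages over roots of unity of large order
    replace integrals over the circle. The price is a multiple of [eta], removed by letting [eta]
    tend to 0 for fixed [x] and [n].

    The telescoping leaves no low-frequency remainder: [h_0] has degree 0, and the alternating
    binomial sum of a constant vanishes because [m > 0]. *)

Section RealNorm.
Variable R : realType.
Local Notation C := (Cplx R).

Lemma rnormE (V : normedModType C) (x : V) : `|x| = (rnorm x)%:C%C.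
Proof. by rewrite [LHS]complexE (ger0_Im (normr_ge0 x)) mulr0 addr0. Qed.

Lemma rnorm_ge0 (V : normedModType C) (x : V) : 0 <= rnorm x.
Proof. by have := normr_ge0 x; rewrite rnormE lecR. Qed.

Lemma rnorm_eq0 (V : normedModType C) (x : V) : (rnorm x == 0) = (x == 0).
Proof. by rewrite -[RHS]normr_eq0 rnormE (inj_eq (@complexI R)). Qed.

Lemma rnorm0 (V : normedModType C) : rnorm (0 : V) = 0.
Proof. by apply/eqP; rewrite rnorm_eq0. Qed.

Lemma ler_rnormD (V : normedModType C) (x y : V) :
  rnorm (x + y) <= rnorm x + rnorm y.
Proof. by have := ler_normD x y; rewrite !rnormE -rmorphD lecR. Qed.

Lemma rnormN (V : normedModType C) (x : V) : rnorm (- x) = rnorm x.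
Proof. by rewrite /rnorm normrN. Qed.

Lemma ler_rnormB (V : normedModType C) (x y : V) :
  rnorm (x - y) <= rnorm x + rnorm y.
Proof. by rewrite -(rnormN y) ler_rnormD. Qed.

Lemma rdistC (V : normedModType C) (x y : V) : rnorm (x - y) = rnorm (y - x).
Proof. by rewrite -rnormN opprB. Qed.

Lemma rnormZ (V : normedModType C) (a : C) (x : V) :
  rnorm (a *: x) = rnorm a * rnorm x.
Proof. by apply: (@complexI R); rewrite rmorphM /= -!rnormE normrZ. Qed.

Lemma rnormM (a b : C) : rnorm (a * b) = rnorm a * rnorm b.
Proof. by apply: (@complexI R); rewrite rmorphM /= -!rnormE normrM. Qed.

Lemma rnorm1 : rnorm (1 : C) = 1.
Proof. by rewrite /rnorm normr1. Qed.

Lemma rnormX (a : C) n : rnorm (a ^+ n) = rnorm a ^+ n.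
Proof. by elim: n => [|n IH]; rewrite ?expr0 ?rnorm1// !exprS rnormM IH. Qed.

Lemma rnormV (a : C) : rnorm a^-1 = (rnorm a)^-1.
Proof. by apply: (@complexI R); rewrite fmorphV /= -!rnormE normfV. Qed.

Lemma rnorm_nat n : rnorm (n%:R : C) = n%:R.
Proof. by apply: (@complexI R); rewrite -rnormE rmorph_nat normr_nat. Qed.

Lemma rnorm_conj (a : C) : rnorm a^*%R = rnorm a.
Proof. by rewrite /rnorm norm_conjC. Qed.

Lemma rnorm_sum (V : normedModType C) I (r : seq I) (P : pred I) (F : I -> V) :
  rnorm (\sum_(i <- r | P i) F i) <= \sum_(i <- r | P i) rnorm (F i).
Proof.
elim/big_ind2: _ => [|x y u v h1 h2|//]; first by rewrite rnorm0.
by apply: le_trans (ler_rnormD _ _) (lerD h1 h2).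
Qed.

End RealNorm.

Section Bernstein.
Variables (R : realType) (V : normedModType (Cplx R)).
Implicit Types (F G : R -> V) (C s M a b : R).

Definition fdiff F : R -> V := fun t => F (t + 1) - F t.

Definition translate u F : R -> V := fun t => F (t + u).

Definition cdiff n F : R -> V := fun t => F (t + n%:R) - F (t - n%:R).

(* A discrete form of exponential type: bounds on the iterated unit differences
   replace bounds on the derivatives. *)
Definition exp_type s C F := forall j t, rnorm (iter j fdiff F t) <= C * s ^+ j.

Lemma iter_fdiffD j F G : iter j fdiff (F + G) = iter j fdiff F + iter j fdiff G.
Proof.
elim: j => // j; rewrite !iterS => ->.
by apply/funext => t; rewrite /fdiff /= !fctE opprD addrACA.
Qed.

Lemma iter_fdiffZ j (c : Cplx R) F : iter j fdiff (c *: F) = c *: iter j fdiff F.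
Proof.
elim: j => // j; rewrite !iterS => ->.
by apply/funext => t; rewrite /fdiff /= !fctE scalerBr.
Qed.

Lemma iter_fdiff_shift j u F : iter j fdiff (translate u F) = translate u (iter j fdiff F).
Proof.
elim: j => // j; rewrite !iterS => ->.
by apply/funext => t; rewrite /fdiff /translate /= addrAC.
Qed.

Lemma exp_typeD s C1 C2 F G :
  exp_type s C1 F -> exp_type s C2 G -> exp_type s (C1 + C2) (F + G).
Proof.
move=> hF hG j t; rewrite iter_fdiffD fctE mulrDl.
exact: le_trans (ler_rnormD _ _) (lerD (hF j t) (hG j t)).
Qed.

Lemma exp_typeZ s C (c : Cplx R) F :
  exp_type s C F -> exp_type s (rnorm c * C) (c *: F).
Proof.
move=> hF j t; rewrite iter_fdiffZ fctE rnormZ -mulrA.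
by rewrite ler_wpM2l ?rnorm_ge0.
Qed.

Lemma exp_typeN s C F : exp_type s C F -> exp_type s C (- F).
Proof.
by move=> h; have := exp_typeZ (-1) h; rewrite rnormN rnorm1 mul1r scaleN1r.
Qed.

Lemma exp_type_shift s C u F : exp_type s C F -> exp_type s C (translate u F).
Proof. by move=> hF j t; rewrite iter_fdiff_shift; exact: hF. Qed.

Lemma exp_type_fdiff s C F : exp_type s C F -> exp_type s (C * s) (fdiff F).
Proof. by move=> hF j t; rewrite -iterSr -mulrA -exprS; exact: hF. Qed.

Lemma exp_type0 s : exp_type s 0 (0 : R -> V).
Proof.
by move=> j t; rewrite -(scale0r (0 : R -> V)) iter_fdiffZ scale0r rnorm0 mul0r.
Qed.

(** [D_n] is a sum of [2n] translates of the unit difference, each of which costs a factor [s]. *)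
Lemma exp_type_cdiff s C n F :
  exp_type s C F -> exp_type s (2 * n%:R * s * C) (cdiff n F).
Proof.
move=> hF; elim: n => [|n IH].
  rewrite mulr0 !mul0r; have -> : cdiff 0 F = 0 by
    apply/funext => t; rewrite /cdiff subr0 addr0 subrr.
  exact: exp_type0.
have -> : cdiff n.+1 F =
    cdiff n F + translate n%:R (fdiff F) + translate (- n.+1%:R) (fdiff F).
  apply/funext => t; rewrite /cdiff /translate /fdiff !fctE.
  rewrite -natr1 (_ : t - (n%:R + 1) + 1 = t - n%:R); last by ring.
  by rewrite addrA [F (t + n%:R) - _ + _]addrC !addrA !subrK.
have hd := exp_type_fdiff hF.
have -> : 2 * n.+1%:R * s * C = 2 * n%:R * s * C + C * s + C * s.
  by rewrite -natr1; ring.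
by apply: exp_typeD (exp_type_shift _ hd); apply: exp_typeD (exp_type_shift _ hd).
Qed.

Lemma cdiffB n F G : cdiff n (F - G) = cdiff n F - cdiff n G.
Proof.
by apply/funext => t; rewrite /cdiff !fctE !opprD !opprK addrACA.
Qed.


(* [T_i = (D_(3n) - T_(i-1)^3) / 3] converges to [D_n], since the central
   differences satisfy [D_(3n) = D_n ^ 3 + 3 D_n]. *)
Fixpoint cubic_iter n i F : R -> V :=
  if i is i'.+1 then
    3^-1 *: (cdiff (3 * n) F - cubic_iter n i' (cubic_iter n i' (cubic_iter n i' F)))
  else 0.

Lemma cdiff3 n F :
  cdiff (3 * n) F = cdiff n (cdiff n (cdiff n F)) + 3 *: cdiff n F.
Proof.
apply/funext => t; rewrite /cdiff !fctE natrM.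
have -> : t + n%:R + n%:R + n%:R = t + 3 * n%:R by ring.
have -> : t - n%:R - n%:R - n%:R = t - 3 * n%:R by ring.
have -> : t + n%:R - n%:R + n%:R = t + n%:R by ring.
have -> : t + n%:R - n%:R - n%:R = t - n%:R by ring.
have -> : t - n%:R + n%:R - n%:R = t - n%:R by ring.
have -> : t - n%:R + n%:R + n%:R = t + n%:R by ring.
have -> : t + n%:R + n%:R - n%:R = t + n%:R by ring.
have -> : t - n%:R - n%:R + n%:R = t - n%:R by ring.
set a := F (t + 3 * _); set b := F (t - 3 * _).
set c := F (t + _); set d := F (t - _).
have {}: forall u x v : V, u - x - (x - v) + 3 *: x = u + v + x.
  move=> u x v; rewrite scaler_nat opprB !mulrS mulr0n addr0 !addrA.
  rewrite -[u - x + v - x + x]addrA addNr addr0.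
  by rewrite [u - x + v + x]addrAC -[u - x + x]addrA addNr addr0.
by move=> ->; rewrite addrAC !addrA !subrK.
Qed.

(** The hypothesis makes [D_(3n)] multiply the constant by at most [6/5], and by induction three
    nested applications of the previous iterate give [1/8]; [(6/5 + 1/8) / 3] is below [1/2]. *)
Lemma cubic_iter_type s C n i F : 2 * n%:R * s <= 2 / 5 -> 0 <= s -> 0 <= C ->
  exp_type s C F -> exp_type s (C / 2) (cubic_iter n i F).
Proof.
move=> hn s0; elim: i C F => [|i IH] C F C0 hF /=.
  move=> j t; apply: le_trans (@exp_type0 s j t) _.
  by rewrite mul0r mulr_ge0 ?exprn_ge0// divr_ge0.
have h1 := IH _ _ C0 hF.
have h2 := IH _ _ (divr_ge0 C0 (ler0n _ _)) h1.
have h3 := IH _ _ (divr_ge0 (divr_ge0 C0 (ler0n _ _)) (ler0n _ _)) h2.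
have h := exp_typeZ 3^-1 (exp_typeD (exp_type_cdiff (3 * n) hF) (exp_typeN h3)).
move=> j t; apply: le_trans (h j t) _; rewrite ler_wpM2r ?exprn_ge0//.
rewrite rnormV rnorm_nat natrM.
have : 2 * n%:R * s * C <= 2 / 5 * C by rewrite ler_wpM2r.
lra.
Qed.

(** The difference of cubes telescopes as [DDD - TTT = DD(D - T) + D(D - T)T + (D - T)TT], which
    respects the order of the factors. With [x = 2ns <= 2/5] the three terms weigh [x^2], [x/2] and
    [1/4], and a third of their sum is below [1/4]. *)
Lemma cubic_iter_cvg s C n i F : 2 * n%:R * s <= 2 / 5 -> 0 <= s -> 0 <= C ->
  exp_type s C F -> exp_type s (C / 2 / 4 ^+ i) (cdiff n F - cubic_iter n i F).
Proof.
move=> hn s0; elim: i C F => [|i IH] C F C0 hF /=.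
  rewrite subr0 divr1 => j t.
  apply: le_trans (exp_type_cdiff n hF j t) _; rewrite ler_wpM2r ?exprn_ge0//.
  have : 2 * n%:R * s * C <= 2 / 5 * C by rewrite ler_wpM2r.
  lra.
have C2 := divr_ge0 C0 (ler0n R 2).
have C4 := divr_ge0 C2 (ler0n R 2).
have T1 := cubic_iter_type i hn s0 C0 hF.
have T2 := cubic_iter_type i hn s0 C2 T1.
have d1 := exp_type_cdiff n (exp_type_cdiff n (IH _ _ C0 hF)).
have d2 := exp_type_cdiff n (IH _ _ C2 T1).
have d3 := IH _ _ C4 T2.
have -> : cdiff n F - 3^-1 *: (cdiff (3 * n) F -
    cubic_iter n i (cubic_iter n i (cubic_iter n i F))) =
  - (3^-1 *: (cdiff n (cdiff n (cdiff n F - cubic_iter n i F)) +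
     cdiff n (cdiff n (cubic_iter n i F) - cubic_iter n i (cubic_iter n i F)) +
     (cdiff n (cubic_iter n i (cubic_iter n i F)) -
       cubic_iter n i (cubic_iter n i (cubic_iter n i F))))).
  rewrite cdiff3 (cdiffB n (cdiff n F)) (cdiffB n (cdiff n (cdiff n F))).
  rewrite (cdiffB n (cdiff n (cubic_iter n i F))).
  move: (cdiff n (cdiff n (cdiff n F))) => u; move: (cdiff n F) => x.
  move: (cdiff n (cdiff n (cubic_iter n i F))) => y.
  move: (cdiff n (cubic_iter n i (cubic_iter n i F))) => z.
  move: (cubic_iter n i (cubic_iter n i (cubic_iter n i F))) => v.
  have -> : u - y + (y - z) + (z - v) = u - v by rewrite !addrA !subrK.
  rewrite addrAC scalerDr scalerA mulVf ?pnatr_eq0// scale1r.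
  by rewrite opprD addrCA subrr addr0.
move=> j t; apply: le_trans (exp_typeN (exp_typeZ _ (exp_typeD (exp_typeD d1 d2) d3)) j t) _.
rewrite ler_wpM2r ?exprn_ge0// rnormV rnorm_nat exprS invfM.
set y := (4 ^+ i)^-1; have y0 : 0 <= y by rewrite invr_ge0 exprn_ge0.
set x := 2 * _ * _ in hn *.
have x0 : 0 <= x by rewrite !mulr_ge0.
have Cy : 0 <= C * y by rewrite mulr_ge0.
have : x * (C * y) <= 2 / 5 * (C * y) by rewrite ler_wpM2r.
have : x * (x * (C * y)) <= 2 / 5 * (2 / 5 * (C * y)).
  by rewrite ler_pM ?mulr_ge0 ?ler_wpM2r.
lra.
Qed.

(** The bound [a] is the same for every [C]: the type constant serves only for convergence, while
    the size of [D_n F] is measured by the supremum [M]. *)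
Definition cdiff_bound s n a := forall F C M, 0 <= C -> exp_type s C F ->
  (forall t, rnorm (F t) <= M) -> forall t, rnorm (cdiff n F t) <= a * M.

Lemma cdiff_bound2 s n : cdiff_bound s n 2.
Proof.
move=> F C M _ _ hM t; rewrite mulr_natl mulr2n.
exact: le_trans (ler_rnormB _ _) (lerD (hM _) (hM _)).
Qed.

(** If an iterate is bounded by [b M], the next one is bounded by [(a + b^3) M / 3], so [b] persists
    as soon as [a <= 3 b - b^3]. The limit [D_n] inherits the bound, as the type constant of the
    error is [C / 2 / 4^i]. *)
Lemma cdiff_bound_cubic s n a b : 0 <= s -> 0 <= b -> 2 * n%:R * s <= 2 / 5 ->
  a <= 3 * b - b ^+ 3 -> cdiff_bound s (3 * n) a -> cdiff_bound s n b.
Proof.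
move=> s0 b0 hn hab hQ F C M C0 hF hM t.
have hT i : forall F C M, 0 <= C -> exp_type s C F ->
    (forall t, rnorm (F t) <= M) -> forall t, rnorm (cubic_iter n i F t) <= b * M.
  elim: i => [|i IH] {}F {}C {}M {}C0 {}hF {}hM {}t /=.
    by rewrite rnorm0 mulr_ge0// (le_trans (rnorm_ge0 (F 0))).
  have C2 := divr_ge0 C0 (ler0n R 2); have C4 := divr_ge0 C2 (ler0n R 2).
  have T1 := cubic_iter_type i hn s0 C0 hF.
  have T2 := cubic_iter_type i hn s0 C2 T1.
  have h3 := IH _ _ _ C4 T2 (IH _ _ _ C2 T1 (IH _ _ _ C0 hF hM)).
  rewrite fctE rnormZ rnormV rnorm_nat ler_pdivrMl// !fctE.
  apply: le_trans (ler_rnormB _ _) _.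
  apply: le_trans (lerD (hQ _ _ _ C0 hF hM _) (h3 _)) _.
  rewrite !mulrA -mulrDl ler_wpM2r ?(le_trans (rnorm_ge0 (F 0)))//.
  by rewrite -lerBrDr -mulrA -expr2 -exprS.
apply/ler_addgt0Pl => e e0.
have [i hi] : exists i, C / 2 / 4 ^+ i <= e.
  have := upper_nthrootP (leqnn (Num.Def.archi_bound (C / 2 / e))).
  move: (Num.Def.archi_bound _) => i hi; exists i.
  rewrite ler_pdivrMr ?exprn_gt0// [e * _]mulrC -ler_pdivrMr//.
  by rewrite (le_trans (ltW hi))// lerXn2r ?nnegrE//; lra.
rewrite -[cdiff n F t](subrK (cubic_iter n i F t)).
apply: le_trans (ler_rnormD _ _) _; apply: lerD (hT _ _ _ _ C0 hF hM _).
apply: le_trans hi; have := cubic_iter_cvg i hn s0 C0 hF 0 t.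
by rewrite expr0 mulr1.
Qed.

(** The numbers [b_j = (4/3) 3^-j (1 - (2/27) 9^-j)] solve [b_j <= 3 b_(j+1) - b_(j+1)^3]: the
    correction factor is chosen so that [3 b_(j+1) - b_j] equals the cube of the leading term
    [(4/3) 3^-(j+1)]. The base case descends once from the trivial bound 2 to 1, since [2 = 3 - 1],
    and [1 <= b_0]. *)
Lemma cdiff_bound_chain s j n : 0 <= s -> 2 * (3 ^ j * n)%:R * s <= 2 / 5 ->
  cdiff_bound s n (4 / 3 / 3 ^+ j * (1 - 2 / 27 / 9 ^+ j)).
Proof.
move=> s0; elim: j n => [|j IH] n hn.
  move=> F C M C0 hF hM t; rewrite mul1n in hn.
  have h1 : cdiff_bound s n 1.
    by apply: (cdiff_bound_cubic _ _ _ _ (@cdiff_bound2 s (3 * n))) => //; lra.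
  have M0 : 0 <= M := le_trans (rnorm_ge0 (F 0)) (hM 0).
  apply: le_trans (h1 F C M C0 hF hM t) _; rewrite ler_wpM2r//.
  by rewrite !expr0; lra.
have x0 : 0 < 3 ^+ j :> R by rewrite exprn_gt0.
have x1 : 1 <= 3 ^+ j :> R by rewrite exprn_ege1// ler1n.
have h9 : 9 ^+ j = 3 ^+ j ^+ 2 :> R.
  by rewrite -exprM mulnC exprM; congr (_ ^+ _); lra.
have h9' : 9 ^+ j.+1 = (3 * 3 ^+ j) ^+ 2 :> R by rewrite exprS h9; ring.
have xn : 3 ^+ j != 0 :> R by rewrite gt_eqF.
have h : 0 <= 2 / 27 / (3 * 3 ^+ j : R) ^+ 2 <= 1.
  rewrite divr_ge0 ?exprn_ge0 ?mulr_ge0//=; try lra.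
  rewrite ler_pdivrMr ?exprn_gt0 ?mulr_gt0//; nra.
apply: (cdiff_bound_cubic _ _ _ _ (IH (3 * n)%N _)) => //.
- rewrite h9' (exprS (3 : R)) mulr_ge0 ?divr_ge0 ?mulr_ge0//; lra.
- apply: le_trans hn; rewrite ler_wpM2r// ler_wpM2l// ler_nat.
  by rewrite leq_pmull// expn_gt0.
- rewrite h9 h9' (exprS (3 : R)); move: (3 ^+ j) x0 x1 xn h => x x0 x1 xn h.
  rewrite -subr_ge0.
  have -> : 3 * (4 / 3 / (3 * x) * (1 - 2 / 27 / (3 * x) ^+ 2)) -
      (4 / 3 / (3 * x) * (1 - 2 / 27 / (3 * x) ^+ 2)) ^+ 3 -
      4 / 3 / x * (1 - 2 / 27 / x ^+ 2) =
      64 / 27 / (3 * x) ^+ 3 * (1 - (1 - 2 / 27 / (3 * x) ^+ 2) ^+ 3) by field.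
  rewrite mulr_ge0 ?divr_ge0 ?exprn_ge0 ?mulr_ge0//; try lra.
  by rewrite subr_ge0 exprn_ile1; lra.
- by rewrite mulnA -expnSr.
Qed.

Theorem bernstein s C M F : 0 < s -> 0 <= C -> exp_type s C F ->
  (forall t, rnorm (F t) <= M) -> forall t, rnorm (cdiff 1 F t) <= 20 * s * M.
Proof.
move=> s0 C0 hF hM t.
have M0 : 0 <= M := le_trans (rnorm_ge0 (F 0)) (hM 0).
have [hs|hs] := leP s (1 / 5); last first.
  apply: le_trans (@cdiff_bound2 s 1 F C M C0 hF hM t) _; rewrite ler_wpM2r//; lra.
(* With [3^j s] within a factor 3 of [1/5], [3^-j < 15 s]; multiplied by [4/3], this is the constant
   20. *)
have [j hj1 hj2] : exists2 j : nat, 3 ^+ j * s <= 1 / 5 & 1 / 5 < 3 ^+ j.+1 * s.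
  have ex : exists j : nat, 1 / 5 < 3 ^+ j.+1 * s.
    set a := Num.Def.archi_bound (1 / 5 / s); exists a.
    rewrite -ltr_pdivrMr//; apply: lt_le_trans (upper_nthrootP (leqnn a)) _.
    by rewrite exprS (@le_trans _ _ (3 ^+ a)) ?lerXn2r ?nnegrE ?ler_peMl ?exprn_ge0//; lra.
  case: (ex_minnP ex) => -[|j] hj hmin; first by exists 0%N => //; lra.
  exists j.+1 => //; rewrite leNgt; apply/negP => /hmin.
  by rewrite ltnn.
have h := @cdiff_bound_chain s j 1 (ltW s0).
apply: le_trans (h _ _ _ _ C0 hF hM t) _.
  by rewrite muln1 natrX; lra.
rewrite ler_wpM2r//.
have x0 : 0 < 3 ^+ j :> R by rewrite exprn_gt0.
have y0 : 0 < 9 ^+ j :> R by rewrite exprn_gt0.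
apply: (@le_trans _ _ (4 / 3 / 3 ^+ j * 1)).
  apply: ler_wpM2l; first by rewrite !divr_ge0// ltW.
  by rewrite gerBl !divr_ge0// ltW.
rewrite mulr1 ler_pdivrMr//; move: hj2; rewrite exprS; nra.
Qed.

Lemma bernstein_iter s C M F m : 0 < s -> 0 <= C -> exp_type s C F ->
  (forall t, rnorm (F t) <= M) ->
  forall t, rnorm (iter m (cdiff 1) F t) <= (20 * s) ^+ m * M.
Proof.
move=> s0 C0 hF hM; have [D D0 [h1 h2]] : exists2 D, 0 <= D &
    exp_type s D (iter m (cdiff 1) F) /\
    forall t, rnorm (iter m (cdiff 1) F t) <= (20 * s) ^+ m * M; last exact: h2.
elim: m => [|m [D D0 [h1 h2]]]; first by exists C; rewrite ?expr0 ?mul1r.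
exists (2 * 1%:R * s * D); first by rewrite !mulr_ge0// ltW.
split; first exact: exp_type_cdiff.
by move=> t; rewrite iterS exprS -mulrA; exact: (bernstein s0 D0 h1 h2).
Qed.

(** The nodes are two apart, so [t = m] places them at [0, 2, ..., 2m]. The induction is Pascal's
    rule, each term being split between the two shifts. *)
Lemma iter_cdiff1 m F t : iter m (cdiff 1) F t =
  \sum_(k < m.+1) ((-1) ^+ (m - k) * 'C(m, k)%:R) *: F (t + 2 * k%:R - m%:R).
Proof.
elim: m t => [|m IH] t.
  by rewrite big_ord1 /= expr0 mul1r bin0 scale1r mulr0 addr0 subr0.
rewrite iterS /cdiff !IH.
have split k : ((-1) ^+ (m.+1 - k) * 'C(m.+1, k)%:R) *: F (t + 2 * k%:R - m.+1%:R) =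
    ((-1) ^+ (m.+1 - k) * 'C(m, k)%:R) *: F (t + 2 * k%:R - m.+1%:R) +
    ((-1) ^+ (m.+1 - k) * (if k is k'.+1 then 'C(m, k') else 0%N)%:R) *:
       F (t + 2 * k%:R - m.+1%:R).
  rewrite -scalerDl -mulrDr -natrD; case: k => [|k]; first by rewrite !bin0.
  by rewrite binS.
rewrite (eq_bigr _ (fun k _ => split (nat_of_ord k))) big_split /=.
rewrite [X in _ = X + _]big_ord_recr [X in _ = _ + X]big_ord_recl /= bin_small//.
rewrite !mulr0 !scale0r addr0 add0r addrC.
congr (_ + _).
  rewrite -sumrN; apply: eq_bigr => k _.
  have -> : t + 2 * k%:R - m.+1%:R = t - 1 + 2 * k%:R - m%:R by rewrite -natr1; ring.
  have km : (k <= m)%N by rewrite -ltnS.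
  by rewrite subSn// [(-1) ^+ (_ - _).+1]exprS mulN1r mulNr scaleNr.
apply: eq_bigr => k _; rewrite /bump /= add1n subSS.
have -> // : t + 2 * k.+1%:R - m.+1%:R = t + 1 + 2 * k%:R - m%:R.
by rewrite -!natr1; ring.
Qed.

End Bernstein.

(** * Averages over roots of unity and polynomials of operators *)

(** [X^n - 1] is separable, hence has [n] distinct roots, and a field with that many [n]-th roots of
    unity has a primitive one. *)
Lemma closed_prim_root (F : numClosedFieldType) n :
  (n > 0)%N -> {z : F | n.-primitive_root z}.
Proof.
pose p : {poly F} := 'X^n - 1; have [r Dp] := closed_field_poly_normal p.
move=> n_gt0; apply/sigW; rewrite (monicP _) ?monicXnsubC // scale1r in Dp.
have rn1 : all n.-unity_root r by apply/allP => z; rewrite -root_prod_XsubC -Dp.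
have sz_r : (n < (size r).+1)%N.
  by rewrite -(size_prod_XsubC r id) -Dp size_XnsubC.
have [|z] := hasP (has_prim_root n_gt0 rn1 _ sz_r); last by exists z.
by rewrite -separable_prod_XsubC -Dp separable_Xn_sub_1 // pnatr_eq0 -lt0n.
Qed.

Section Averages.
Variable R : realType.
Local Notation C := (Cplx R).

Lemma circleE (z : C) : circle z <-> rnorm z = 1.
Proof.
rewrite /circle /= rnormE; split=> [|->//].
by move=> h; apply: (@complexI R).
Qed.

Lemma circle_neq0 (z : C) : circle z -> z != 0.
Proof. by rewrite -normr_eq0 => ->; rewrite oner_eq0. Qed.

Lemma circleM (z y : C) : circle z -> circle y -> circle (z * y).
Proof. by rewrite /circle /= normrM => -> ->; rewrite mulr1. Qed.

Lemma circleX (z : C) n : circle z -> circle (z ^+ n).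
Proof. by rewrite /circle /= normrX => ->; rewrite expr1n. Qed.

Lemma circle_conj (z : C) : circle z -> z^*%R = z^-1.
Proof. by move=> hz; rewrite invC_norm (hz : `|z| = 1) expr1n invr1 mul1r. Qed.

Lemma circleV (z : C) : circle z -> circle z^-1.
Proof. by rewrite /circle /= normfV => ->; rewrite invr1. Qed.

Lemma prim_root_circle (z : C) L : L.-primitive_root z -> circle z.
Proof.
move=> hz; apply/eqP; rewrite -(@pexpr_eq1 _ `|z| L) ?(prim_order_gt0 hz)//.
by rewrite -normrX (prim_expr_order hz) normr1.
Qed.

(** Orthogonality of characters: averaging over the [L]-th roots of unity is exact integration over
    the circle for frequencies below [L] in absolute value. *)
Lemma prim_root_sum (z : C) L (e : int) : L.-primitive_root z ->
  (`|e|%N < L)%N -> \sum_(j < L) (z ^+ j) ^ e = if e == 0 then L%:R else 0.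
Proof.
move=> hz he; case: eqP => [->|/eqP e0].
  by rewrite (eq_bigr (fun=> 1)) ?sumr_const ?card_ord// => j _; rewrite expr0z.
pose y := z ^ e.
have yE j : (z ^+ j) ^ e = y ^+ j.
  by rewrite /y !exprnP exprzAC.
rewrite (eq_bigr _ (fun (j : 'I_L) _ => yE j)).
have yL : y ^+ L = 1 by rewrite -yE (prim_expr_order hz) exp1rz.
have y1 : y != 1.
  apply/negP => /eqP; rewrite /y; case: e e0 he {yE yL y} => n e0 he.
    move=> h; have := eq_prim_root_expr hz n 0.
    rewrite expr0 -exprnP in h *; rewrite h eqxx => /esym.
    by rewrite /eqn mod0n modn_small// => /eqP n0; rewrite n0 in e0.
  rewrite NegzE -exprnN => /(congr1 GRing.inv); rewrite invrK invr1 => h.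
  have := eq_prim_root_expr hz n.+1 0.
  by rewrite expr0 h eqxx => /esym; rewrite mod0n modn_small.
apply/eqP; have /eqP := subrX1 y L.
by rewrite yL subrr eq_sym mulf_eq0 subr_eq0 (negPf y1).
Qed.

(** Cauchy's estimate, with the coefficient recovered as an average over roots of unity. The order
    [L] exceeds every [|k - i|], so no other coefficient is aliased onto [i]. *)
Lemma coef_le (p : {poly C}) M i :
  (forall z, circle z -> rnorm p.[z] <= M) -> rnorm p`_i <= M.
Proof.
move=> hM; pose L := (size p + i).+1.
have [z hz] := closed_prim_root C (ltn0Sn (size p + i)).
have cz j : circle (z ^+ j) by apply: circleX (prim_root_circle hz).
have <- : L%:R^-1 * \sum_(j < L) (z ^+ j) ^ (- i%:Z) * p.[z ^+ j] = p`_i.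
  have L0 : L%:R != 0 :> C by rewrite pnatr_eq0.
  under eq_bigr do rewrite horner_coef mulr_sumr.
  rewrite exchange_big /=.
  transitivity (L%:R^-1 * \sum_(k < size p) p`_k * (if (k == i :> nat) then L%:R else 0 : C)).
    congr (_ * _); apply: eq_bigr => k _.
    have := @prim_root_sum z L (k%:Z - i%:Z) hz.
    rewrite subr_eq0 eqz_nat => <-; last by rewrite /L; case: k => k /= hk; lia.
    rewrite mulr_sumr; apply: eq_bigr => j _.
    rewrite mulrCA expfzDr ?circle_neq0// [_ ^ (- _) * _]mulrC.
    by rewrite -exprnP.
  have [hi|hi] := ltnP i (size p).
    rewrite (bigD1 (Ordinal hi)) //= eqxx big1 ?addr0 => [|k hk].
      by rewrite mulrCA mulVf ?mulr1.
    by move: hk; rewrite -val_eqE /= => /negPf ->; rewrite mulr0.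
  rewrite nth_default// big1 ?mulr0// => k _.
  by rewrite ltn_eqF ?mulr0// (leq_trans (ltn_ord k)).
rewrite rnormM rnormV rnorm_nat ler_pdivrMl ?ltr0n//.
apply: le_trans (rnorm_sum _ _ _) _.
have -> : L%:R * M = \sum_(j < L) M by rewrite sumr_const card_ord mulr_natl.
apply: ler_sum => j _; rewrite rnormM.
suff -> : rnorm ((z ^+ j) ^ (- i%:Z)) = 1 by rewrite mul1r hM.
by rewrite -exprnN rnormV rnormX (circleE _).1 ?expr1n ?invr1.
Qed.

(** The reciprocal polynomial: on the circle it is [z^d] times the conjugate of [p], so that [|p|^2]
    is a polynomial up to a power of [z]. *)
Definition conj_rev d (p : {poly C}) : {poly C} := \poly_(i < d.+1) (p`_(d - i))^*%R.

Lemma conj_rev_horner d (p : {poly C}) z : (size p <= d.+1)%N -> circle z ->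
  (conj_rev d p).[z] = z ^+ d * (p.[z])^*%R.
Proof.
move=> hp hz; rewrite horner_poly (horner_coef_wide _ hp) rmorph_sum mulr_sumr.
rewrite (reindex_inj rev_ord_inj) /=; apply: eq_bigr => i _.
have hi : (i <= d)%N by rewrite -ltnS.
rewrite subSS subKn// rmorphM rmorphXn /= (circle_conj hz) mulrCA; congr (_ * _).
by rewrite exprVn -expfB_cond ?circle_neq0 ?hi ?orbT// (negPf (circle_neq0 hz)).
Qed.

End Averages.

Section Operators.
Variable R : realType.
Local Notation C := (Cplx R).
Variables (H : normedModType C).

Definition pev (p : {poly C}) (V : H -> H) (x : H) : H :=
  \sum_(i < size p) p`_i *: iter i V x.

Lemma pev_wide n (p : {poly C}) V x : (size p <= n)%N -> pev p V x = \sum_(i < n) p`_i *: iter i V x.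
Proof.
move=> hn; rewrite /pev (big_ord_widen _ (fun i => p`_i *: iter i V x) hn).
rewrite big_mkcond; apply: eq_bigr => i _; case: ltnP => // h.
by rewrite nth_default// scale0r.
Qed.

Lemma pevD p q V x : pev (p + q) V x = pev p V x + pev q V x.
Proof.
rewrite (pev_wide _ _ (size_polyD p q)) (pev_wide V x (leq_maxl (size p) (size q))).
rewrite (pev_wide V x (leq_maxr (size p) (size q))) -big_split.
by apply: eq_bigr => i _; rewrite coefD scalerDl.
Qed.

Lemma pevZ a p V x : pev (a *: p) V x = a *: pev p V x.
Proof.
rewrite (pev_wide _ _ (size_scale_leq a p)) /pev scaler_sumr.
by apply: eq_bigr => i _; rewrite coefZ scalerA.
Qed.

Lemma pevB p q V x : pev (p - q) V x = pev p V x - pev q V x.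
Proof. by rewrite pevD -scaleN1r pevZ scaleN1r. Qed.

Lemma pevC a V x : pev a%:P V x = a *: x.
Proof. by rewrite (pev_wide V x (size_polyC_leq1 a)) big_ord1 coefC. Qed.

Lemma pev0 V x : pev 0 V x = 0.
Proof. by rewrite /pev size_poly0 big_ord0. Qed.

Lemma pevMX (p : {poly C}) V x : pev (p * 'X) V x = pev p V (V x).
Proof.
have h : (size (p * 'X)%R <= (size p).+1)%N.
  by have [->|p0] := eqVneq p 0; rewrite ?mul0r ?size_poly0// size_mulX.
rewrite (pev_wide V x h) big_ord_recl coefMX eqxx scale0r add0r.
by apply: eq_bigr => i _; rewrite coefMX /= -iterSr.
Qed.

Section Linear.
Variable V : {linear H -> H}.

Lemma pev_comm p (T : {linear H -> H}) x :
  (forall y, T (V y) = V (T y)) -> T (pev p V x) = pev p V (T x).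
Proof.
move=> hT; rewrite /pev linear_sum; apply: eq_bigr => i _; rewrite linearZ /=.
by congr (_ *: _); elim: (nat_of_ord i) => //= j <-.
Qed.

Lemma pevM p q x : pev (p * q) V x = pev p V (pev q V x).
Proof.
elim/poly_ind: p x => [|p c IH] x.
  by rewrite mul0r !pev0.
rewrite mulrDl pevD mulrAC pevMX mul_polyC pevZ IH pevD pevMX pevC.
by rewrite (@pev_comm q V).
Qed.

Lemma pevDx p x y : pev p V (x + y) = pev p V x + pev p V y.
Proof.
elim/poly_ind: p x y => [|p c IH] x y; first by rewrite !pev0 addr0.
by rewrite !pevD !pevMX !pevC linearD IH scalerDr addrACA.
Qed.

Lemma pevZx p a x : pev p V (a *: x) = a *: pev p V x.
Proof.
elim/poly_ind: p x => [|p c IH] x; first by rewrite !pev0 scaler0.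
by rewrite !pevD !pevMX !pevC linearZ IH scalerDr !scalerA mulrC.
Qed.

End Linear.
End Operators.

(** * Von Neumann's inequality *)

(** Linear factors disappear under [n]-th roots. If [r = y / z > 1], the square of Bernoulli's
    inequality makes [r^(2^(j+1))] grow at least quadratically in [2^j], against a linear bound. *)
Lemma ler_of_pow2_growth (R : realType) (K y z : R) : 0 <= K -> 0 <= y -> 0 <= z ->
  (forall j, y ^+ (2 ^ j) <= (K * (2 ^ j)%:R + 1) * z ^+ (2 ^ j)) -> y <= z.
Proof.
move=> K0 y0; rewrite le_eqVlt => /predU1P[<- h|z0 h].
  have := h 0%N; rewrite expn0 !expr1 mulr0; exact.
rewrite leNgt; apply/negP => zy.
pose r := y / z; have r1 : 1 < r by rewrite ltr_pdivlMr// mul1r.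
have {}h j : r ^+ (2 ^ j) <= K * (2 ^ j)%:R + 1.
  by rewrite expr_div_n ler_pdivrMr ?exprn_gt0.
have hb k : 1 + k%:R * (r - 1) <= r ^+ k.
  elim: k => [|k IH]; first by rewrite mul0r addr0 expr0.
  rewrite exprS -natr1.
  have : r * (1 + k%:R * (r - 1)) <= r * r ^+ k by rewrite ler_wpM2l//; lra.
  have : 0 <= k%:R * (r - 1) * (r - 1) by rewrite !mulr_ge0 ?subr_ge0 ?(ltW r1).
  lra.
pose d := r - 1; have d0 : 0 < d by rewrite subr_gt0.
have := upper_nthrootP (leqnn (Num.Def.archi_bound ((2 * K + 1) / d ^+ 2))).
move: (Num.Def.archi_bound _) => j; rewrite ltr_pdivrMr ?exprn_gt0//.
have := h j.+1; have := hb (2 ^ j)%N; rewrite -/d.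
rewrite expnSr exprM natrM natrX; set k : R := 2 ^+ j; set u := r ^+ _ => h1 h2 h3.
have k1 : 1 <= k by rewrite exprn_ege1// ler1n.
have h4 : (1 + k * d) * (1 + k * d) <= u * u by rewrite ler_pM ?addr_ge0 ?mulr_ge0//; lra.
have : (2 * K + 1) * k < k * d ^+ 2 * k by rewrite ltr_pM2r//; lra.
have : 0 <= k * d by rewrite mulr_ge0; lra.
nra.
Qed.

Section Hilbert.
Variable R : realType.
Local Notation C := (Cplx R).
Variables (H : completeNormedModType C) (dot : {dot H for Num.conj}).
Hypothesis hdot : forall x : H, `|x| ^+ 2 = dot x x.

Lemma dot_rnorm (x : H) : dot x x = ((rnorm x) ^+ 2)%:C%C.
Proof. by rewrite -hdot rnormE rmorphXn. Qed.

Lemma dotC (x y : H) : dot x y = (dot y x)^*%R.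
Proof. by rewrite hermC expr0 mul1r. Qed.

Lemma cauchy_schwarz (x y : H) : rnorm (dot x y) <= rnorm x * rnorm y.
Proof.
have [->|y0] := eqVneq y 0; first by rewrite linear0r !rnorm0 mulr0.
have ry : 0 < rnorm y by rewrite lt_neqAle rnorm_ge0 eq_sym rnorm_eq0 y0.
pose a := dot y y; pose b := dot x y.
have := dnorm_ge0 dot (a *: x - b *: y).
rewrite linearBl /= !linearBr /= !linearZl !linearZr /=.
rewrite (dotC y x) -/a -/b.
have -> : a^*%R = a by rewrite /a -dotC.
have -> : a * (a * dot x x) - a * (b^*%R * b) - (b * (a * b^*%R) - b * (b^*%R * a)) =
  a * (a * dot x x - b * b^*%R) by ring.
have -> : b * b^*%R = (rnorm b ^+ 2)%:C%C.
  by rewrite -normCK rnormE rmorphXn.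
rewrite /a !dot_rnorm -!rmorphM -rmorphB -rmorphM /= -[0]/(0%:C%C) lecR.
rewrite pmulr_rge0 ?exprn_gt0// subr_ge0 -exprMn => h.
by rewrite -(@ler_pXn2r _ 2) ?nnegrE ?mulr_ge0 ?rnorm_ge0// mulrC.
Qed.

Lemma dot_inj (x y : H) : (forall z, dot z x = dot z y) -> x = y.
Proof.
move=> h; apply/eqP; rewrite -subr_eq0 -(dnorm_eq0 dot).
by rewrite linearBr /= h subrr.
Qed.

Section Unitary.
Variables V V' : {linear H -> H}.
Hypotheses (VV' : is_adjoint dot V V') (VK : cancel V V') (V'K : cancel V' V).

Lemma isometry_of_adjoint x : rnorm (V x) = rnorm x.
Proof.
apply/eqP; rewrite -(@eqrXn2 _ 2) ?rnorm_ge0//; apply/eqP.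
by apply: (@complexI R); rewrite -!dot_rnorm VV' VK.
Qed.

Lemma isometry_of_adjointV x : rnorm (V' x) = rnorm x.
Proof. by rewrite -[in RHS](V'K x) isometry_of_adjoint. Qed.

Lemma iter_inv i j x : (i <= j)%N -> iter j V' (iter (j - i) V x) = iter i V' x.
Proof.
move=> /subnK <-; rewrite addnK addnC iterD; congr (iter _ _ _).
by elim: (j - i)%N => //= n IH; rewrite -[LHS]iterS iterSr VK.
Qed.

Lemma adjoint_iter i x y : dot (iter i V x) y = dot x (iter i V' y).
Proof. by elim: i x y => // i IH x y; rewrite iterS VV' IH -iterSr. Qed.

Lemma iter_linear (T : {linear H -> H}) n : linear (iter n T : H -> H).
Proof. by move=> a x y; elim: n => //= n ->; rewrite linearP. Qed.

(** The adjoint of [V^i] is [V^-i = V^-d V^(d-i)], which reverses the coefficients besides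
    conjugating them. *)
Lemma adjoint_pev d (p : {poly C}) x y : (size p <= d.+1)%N ->
  dot (pev p V x) y = dot x (iter d V' (pev (conj_rev d p) V y)).
Proof.
move=> hp; rewrite (pev_wide V x hp) linear_sumlz.
have -> : iter d V' (pev (conj_rev d p) V y) =
    \sum_(i < d.+1) (p`_i)^*%R *: iter i V' y.
  rewrite (pev_wide _ _ (size_poly _ _)).
  have lsum : forall n (f : 'I_n -> H),
      iter d V' (\sum_(i < n) f i) = \sum_(i < n) iter d V' (f i).
    move=> n f; elim: d {hp} => //= d ->; exact: linear_sum.
  have lZ : forall a z, iter d V' (a *: z) = a *: iter d V' z.
    by move=> a z; elim: d {hp lsum} => //= d ->; rewrite linearZ.
  rewrite lsum (reindex_inj rev_ord_inj) /=; apply: eq_bigr => i _.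
  have hi : (i <= d)%N by rewrite -ltnS.
  by rewrite lZ coef_poly subSS ltnS leq_subr subKn// iter_inv.
rewrite linear_sumr; apply: eq_bigr => i _.
by rewrite linearZl linearZr /= conjCK adjoint_iter.
Qed.

Lemma iter_isometry (T : H -> H) n x :
  (forall x, rnorm (T x) = rnorm x) -> rnorm (iter n T x) = rnorm x.
Proof. by move=> hT; elim: n => //= n <-. Qed.

(* [T = p(V)] is normal, so the norm of [T^* T] is the limit of
   [| (T^* T) ^ n | ^ (1 / n)], while [(T^* T) ^ n] has [O(n)] coefficients, all
   at most [M ^ 2n]. *)
Theorem von_neumann (p : {poly C}) M x : (forall z, circle z -> rnorm p.[z] <= M) ->
  rnorm (pev p V x) <= M * rnorm x.
Proof.
move=> hM; pose d := size p; have hp : (size p <= d.+1)%N by [].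
have M0 : 0 <= M by apply: le_trans (rnorm_ge0 _) (hM 1 _); rewrite /circle /= normr1.
pose q := conj_rev d p * p.
(* By [adjoint_pev], [B] is [T^* T]. Powers of [V'] commute with polynomials in [V], so the powers
   of [B] come from those of [q]. *)
pose B y := iter d V' (pev q V y).
have cV'V y : V' (V y) = V (V' y) by rewrite VK V'K.
have V'pev n r y : iter n V' (pev r V y) = pev r V (iter n V' y).
  by elim: n => //= n ->; rewrite (pev_comm r _ cV'V).
have BE n y : iter n B y = iter (n * d) V' (pev (q ^+ n) V y).
  elim: n => [|n IH]; first by rewrite expr0 -[1]/(1%:P) pevC scale1r.
  by rewrite iterS IH /B -V'pev -iterD exprS (pevM V q) mulSn.
have Bsym y z : dot (B y) z = dot y (B z).
  have h u v : dot u (B v) = dot (pev p V u) (pev p V v).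
    by rewrite (adjoint_pev _ _ hp) /B pevM.
  by rewrite dotC !h -dotC.
have Bn_sym n y z : dot (iter n B y) z = dot y (iter n B z).
  by elim: n y z => // n IH y z; rewrite iterS Bsym IH -iterSr.
have [x0|x0] := eqVneq x 0.
  by rewrite x0 -[X in pev p V X](scale0r (0 : H)) pevZx scale0r rnorm0 mulr0.
have nx : 0 < rnorm x by rewrite lt_neqAle rnorm_ge0 eq_sym rnorm_eq0 x0.
(* Symmetry of [B] and Cauchy-Schwarz. Repeated doubling turns this into [bpow], so that the growth
   of [|B^(2^j) x|] alone controls [|B x|]. *)
have b2 n : rnorm (iter n B x) ^+ 2 <= rnorm x * rnorm (iter (n + n) B x).
  rewrite -lecR -dot_rnorm Bn_sym -iterD.
  apply: le_trans (_ : `|dot x (iter (n + n) B x)| <= _).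
    rewrite -[X in X <= _]ger0_norm// iterD -Bn_sym; exact: dnorm_ge0.
  by rewrite rnormE lecR cauchy_schwarz.
have bpow j : rnorm (B x) ^+ (2 ^ j) * rnorm x <= rnorm (iter (2 ^ j) B x) * rnorm x ^+ (2 ^ j).
  elim: j => [|j IH]; first by rewrite expn0 !expr1.
  rewrite -(ler_pM2r nx).
  have : (rnorm (B x) ^+ (2 ^ j) * rnorm x) ^+ 2 <=
     (rnorm (iter (2 ^ j) B x) * rnorm x ^+ (2 ^ j)) ^+ 2.
    by rewrite lerXn2r ?nnegrE ?mulr_ge0 ?exprn_ge0 ?rnorm_ge0.
  rewrite !exprMn -!exprM -!expnSr expr2 mulrA => /le_trans; apply.
  rewrite -[X in _ <= X]mulrA [_ * rnorm x]mulrC mulrA [X in _ <= X * _]mulrC.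
  by rewrite ler_wpM2r ?exprn_ge0 ?rnorm_ge0// (le_trans (b2 _))// expnSr muln2 addnn.
have qM z : circle z -> rnorm q.[z] <= M ^+ 2.
  move=> hz; rewrite hornerM conj_rev_horner// !rnormM rnorm_conj rnormX.
  by rewrite (circleE _).1// expr1n mul1r expr2 ler_pM ?rnorm_ge0 ?hM.
have bn n : rnorm (iter n B x) <= ((2 * d)%:R * n%:R + 1) * (M ^+ 2) ^+ n * rnorm x.
  rewrite BE (iter_isometry _ _ isometry_of_adjointV).
  have sz : (size (q ^+ n) <= 2 * d * n + 1)%N.
    apply: leq_trans (size_poly_exp_leq _ _) _.
    have : (size q <= (2 * d).+1)%N.
      apply: leq_trans (size_polyMleq _ _) _.
      have := size_poly d.+1 (fun i => (p`_(d - i))^*%R); rewrite -/(conj_rev d p) => h.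
      by move: h; rewrite -/d; lia.
    by move=> h; rewrite addn1 ltnS leq_mul2r -subn1 leq_subLR add1n h orbT.
  rewrite (pev_wide _ _ sz); apply: le_trans (rnorm_sum _ _ _) _.
  have -> : ((2 * d)%:R * n%:R + 1) * (M ^+ 2) ^+ n * rnorm x =
      \sum_(i < 2 * d * n + 1) (M ^+ 2) ^+ n * rnorm x.
    by rewrite sumr_const card_ord -[RHS]mulr_natl natrD !natrM mulrA.
  apply: ler_sum => i _; rewrite rnormZ (iter_isometry _ _ isometry_of_adjoint).
  rewrite ler_wpM2r ?rnorm_ge0//; apply: coef_le => z hz.
  by rewrite horner_exp rnormX lerXn2r ?nnegrE ?rnorm_ge0 ?exprn_ge0 ?qM.
have hB : rnorm (B x) <= M ^+ 2 * rnorm x.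
  apply: (@ler_of_pow2_growth _ (2 * d)%:R); rewrite ?rnorm_ge0 ?mulr_ge0 ?exprn_ge0 ?rnorm_ge0//.
  move=> j; rewrite -(ler_pM2r nx); apply: le_trans (bpow j) _.
  rewrite exprMn mulrA mulrAC; apply: ler_wpM2r; first by rewrite exprn_ge0// ltW.
  exact: bn.
rewrite -(@ler_pXn2r _ 2) ?nnegrE ?mulr_ge0 ?rnorm_ge0// exprMn.
have -> : rnorm (pev p V x) ^+ 2 = rnorm (dot x (B x)).
  have -> : dot x (B x) = (rnorm (pev p V x) ^+ 2)%:C%C.
    by rewrite -dot_rnorm (adjoint_pev _ _ hp) /B pevM.
  by rewrite /rnorm ger0_norm// lecR exprn_ge0 ?rnorm_ge0.
apply: le_trans (cauchy_schwarz _ _) _.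
by rewrite mulrC [_ ^+ 2 as X in _ <= _ * X]expr2 mulrA ler_wpM2r ?rnorm_ge0.
Qed.

End Unitary.
End Hilbert.

(** * Jackson kernels *)

Section Kernel.
Variable R : realType.
Local Notation C := (Cplx R).

Lemma conjC_mul (a : C) : a * a^*%R = (rnorm a ^+ 2)%:C%C.
Proof. by rewrite -normCK rnormE rmorphXn. Qed.

Section Grid.
Variables (L : nat) (z : C).
Hypothesis hz : L.-primitive_root z.

Let L_gt0 : (0 < L)%N := prim_order_gt0 hz.
Let zj_circle j : circle (z ^+ j).
Proof. exact: circleX (prim_root_circle hz). Qed.

Lemma parseval (p : {poly C}) y : (size p <= L)%N -> circle y ->
  \sum_(j < L) rnorm p.[y * z ^+ j] ^+ 2 = L%:R * \sum_(i < L) rnorm p`_i ^+ 2.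
Proof.
move=> hp hy; apply: (@complexI R); rewrite rmorphM rmorph_nat !rmorph_sum /=.
under eq_bigr do rewrite -conjC_mul (horner_coef_wide _ hp) rmorph_sum big_distrlr /=.
rewrite exchange_big mulr_sumr /=; apply: eq_bigr => a _; rewrite exchange_big /=.
have cy j : circle (y * z ^+ j) by apply: circleM.
transitivity (\sum_(b < L) p`_a * (p`_b)^*%R * (y ^+ a * y ^- b) *
    (if a%:Z - b%:Z == 0 then L%:R else 0)).
  apply: eq_bigr => b _; rewrite -(prim_root_sum hz); last first.
    by case: a b => a /= ha [b /= hb]; lia.
  rewrite mulr_sumr; apply: eq_bigr => j _.
  rewrite rmorphM rmorphXn /= (circle_conj (cy j)) invfM.
  rewrite expfzDr ?circle_neq0//.
  rewrite !exprMn exprVn -exprnP -exprnN exprVn.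
  by ring.
rewrite (bigD1 a)//= subrr eqxx big1 ?addr0 => [|b ba]; last first.
  by rewrite subr_eq0 eqz_nat eq_sym (inj_eq val_inj) (negPf ba) mulr0.
by rewrite mulfV ?expf_neq0 ?circle_neq0// mulr1 conjC_mul mulrC.
Qed.

Variables (m N : nat).
Hypothesis N_gt0 : (0 < N)%N.
Hypothesis NL : (m.+1 * N <= L)%N.

Definition geom_poly : {poly C} := \sum_(i < N) 'X^i.

(** The square of its modulus at [z = e^(iu)] is [(sin (N u / 2) / sin (u / 2))^(2m+2)], the
    unnormalised Jackson kernel. *)
Definition bump_poly : {poly C} := geom_poly ^+ m.+1.

Definition bump_deg := (m.+1 * N.-1)%N.

Lemma geomE : geom_poly = \poly_(i < N) 1.
Proof. by rewrite poly_def; apply: eq_bigr => i _; rewrite scale1r. Qed.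

Lemma size_geom : (size geom_poly <= N)%N.
Proof. by rewrite geomE size_poly. Qed.

Lemma size_bump : (size bump_poly <= bump_deg.+1)%N.
Proof.
apply: leq_trans (size_poly_exp_leq _ _) _; rewrite ltnS mulnC leq_mul2l -!subn1.
by rewrite leq_sub2r ?size_geom ?orbT.
Qed.

Lemma bump_degS : (bump_deg < m.+1 * N)%N.
Proof. by rewrite ltn_mul2l ltn_predL. Qed.

Let size_bumpL : (size bump_poly <= L)%N.
Proof. exact: leq_trans size_bump (leq_trans bump_degS NL). Qed.

Lemma bump1 : bump_poly.[1] = (N ^ m.+1)%:R.
Proof.
rewrite horner_exp /geom_poly horner_sum (eq_bigr (fun=> 1)) => [|i _].
  by rewrite sumr_const card_ord natrX.
by rewrite hornerXn expr1n.
Qed.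

(** Under [NL], Parseval identifies this with the sum of [|bump_poly|^2] over any rotation of the
    [L]-th roots of unity, so it normalises the kernel on all these grids at once. *)
Definition jackson_mass : R := L%:R * \sum_(i < L) rnorm bump_poly`_i ^+ 2.

Lemma sqr_sum_le n (a : nat -> R) :
  (\sum_(i < n) a i) ^+ 2 <= n%:R * \sum_(i < n) a i ^+ 2.
Proof.
elim: n => [|n IH]; first by rewrite !big_ord0 expr0n mul0r.
have h k : 2 * (\sum_(i < k) a i) * a n <= \sum_(i < k) a i ^+ 2 + k%:R * a n ^+ 2.
  elim: k => [|k IHk]; first by rewrite !big_ord0 mulr0 !mul0r addr0.
  rewrite !big_ord_recr /= -natr1; have := sqr_ge0 (a k - a n); nra.
rewrite !big_ord_recr /= -natr1; have := h n; nra.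
Qed.

(** The coefficients of [bump_poly] add up to its value [N^(m+1)] at 1, and at most [(m+1) N] of
    them are nonzero, so Cauchy-Schwarz bounds the sum of their squares from below. *)
Lemma mass_ge : L%:R * N%:R ^+ (2 * m).+1 <= m.+1%:R * jackson_mass.
Proof.
rewrite /jackson_mass mulrCA ler_wpM2l//.
have N0 : 0 < N%:R :> R by rewrite ltr0n.
have e : \sum_(i < L) rnorm bump_poly`_i ^+ 2 =
    \sum_(i < m.+1 * N) rnorm bump_poly`_i ^+ 2.
  rewrite [in RHS](big_ord_widen _ (fun i => rnorm bump_poly`_i ^+ 2) NL).
  rewrite [in RHS]big_mkcond; apply: eq_bigr => i _; case: ltnP => // hi.
  by rewrite nth_default ?rnorm0 ?expr0n//; apply: leq_trans (leq_trans size_bump bump_degS) hi.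
rewrite -(ler_pM2l N0) mulrA -natrM [(N * _)%N]mulnC e.
apply: le_trans (sqr_sum_le _ (fun i => rnorm bump_poly`_i)).
rewrite -exprS (_ : (2 * m).+2 = m.+1 * 2)%N; last by lia.
rewrite exprM lerXn2r ?nnegrE ?exprn_ge0 ?sumr_ge0// => [i _|]; first exact: rnorm_ge0.
rewrite -natrX -rnorm_nat -bump1 (horner_coef_wide _ (leq_trans size_bump bump_degS)).
apply: le_trans (rnorm_sum _ _ _) _.
by apply: ler_sum => i _; rewrite expr1n mulr1.
Qed.

Lemma mass_gt0 : 0 < jackson_mass.
Proof.
have : 0 < m.+1%:R * jackson_mass.
  by apply: lt_le_trans mass_ge; rewrite mulr_gt0 ?exprn_gt0 ?ltr0n.
by rewrite pmulr_rgt0 ?ltr0n.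
Qed.

Definition jackson_kernel (y : C) : R := rnorm bump_poly.[y] ^+ 2 / jackson_mass.

Lemma kernel_ge0 y : 0 <= jackson_kernel y.
Proof. by rewrite divr_ge0 ?exprn_ge0 ?rnorm_ge0// ltW// mass_gt0. Qed.

Lemma kernel_sum y : circle y -> \sum_(j < L) jackson_kernel (y * z ^+ j) = 1.
Proof. by move=> hy; rewrite -mulr_suml parseval// divff// gt_eqF// mass_gt0. Qed.

(** Of the [m+1] geometric factors, [m] turn [(1 - X)^m] into [(1 - X^N)^m], of modulus at most
    [2^m] on the circle; the remaining one has [N] unit coefficients, so Parseval gives [L N]. The
    quotient by the mass is controlled by [mass_ge]. *)
Lemma kernel_moment y : circle y ->
  N%:R ^+ (2 * m) * \sum_(j < L) jackson_kernel (y * z ^+ j) * rnorm (1 - y * z ^+ j) ^+ (2 * m)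
  <= m.+1%:R * 4 ^+ m.
Proof.
move=> hy.
have -> : \sum_(j < L) jackson_kernel (y * z ^+ j) * rnorm (1 - y * z ^+ j) ^+ (2 * m) =
   (\sum_(j < L) rnorm ((1 - 'X^N) ^+ m * geom_poly).[y * z ^+ j] ^+ 2) / jackson_mass.
  rewrite mulr_suml; apply: eq_bigr => j _; rewrite mulrAC; congr (_ / _).
  rewrite mulnC exprM -exprMn -rnormX -rnormM; congr (rnorm _ ^+ 2).
  have -> : (1 - 'X^N) ^+ m * geom_poly = (1 - 'X) ^+ m * bump_poly.
    have -> : 1 - 'X^N = (1 - 'X) * geom_poly.
      by rewrite -opprB subrX1 -mulNr opprB.
    by rewrite exprMn /bump_poly exprSr mulrA.
  by rewrite hornerM horner_exp !hornerE mulrC.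
rewrite mulrA ler_pdivrMr ?mass_gt0//.
have h : \sum_(j < L) rnorm ((1 - 'X^N) ^+ m * geom_poly).[y * z ^+ j] ^+ 2 <=
    4 ^+ m * (L%:R * N%:R).
  apply: le_trans (_ : \sum_(j < L) 4 ^+ m * rnorm geom_poly.[y * z ^+ j] ^+ 2 <= _).
    apply: ler_sum => j _; rewrite hornerM rnormM exprMn ler_wpM2r ?exprn_ge0 ?rnorm_ge0//.
    rewrite horner_exp rnormX -exprM mulnC exprM lerXn2r ?nnegrE ?exprn_ge0 ?rnorm_ge0//.
    rewrite (_ : 4 = 2 ^+ 2); last by ring.
    rewrite lerXn2r ?nnegrE ?rnorm_ge0// !hornerE.
    apply: le_trans (ler_rnormB _ _) _.
    rewrite rnorm1 rnormX (circleE _).1; last exact: circleM.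
    by rewrite expr1n.
  rewrite -mulr_sumr ler_wpM2l ?exprn_ge0// parseval//; last first.
    by apply: leq_trans size_geom (leq_trans _ NL); rewrite leq_pmull.
  rewrite ler_wpM2l// (_ : N%:R = \sum_(i < N) 1); last by rewrite sumr_const card_ord.
  have NL' : (N <= L)%N by apply: leq_trans NL; rewrite leq_pmull.
  rewrite (big_ord_widen _ (fun i => 1) NL') [X in _ <= X]big_mkcond.
  apply: ler_sum => i _; rewrite geomE coef_poly; case: ifP => _.
    by rewrite rnorm1 expr1n.
  by rewrite rnorm0 expr0n.
apply: le_trans (ler_wpM2l _ h) _; first by rewrite exprn_ge0.
rewrite [m.+1%:R * _]mulrC -mulrA mulrCA ler_wpM2l ?exprn_ge0//.
by apply: le_trans mass_ge; rewrite exprSr mulrCA mulrA.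
Qed.

Definition kernel_poly : {poly C} := conj_rev bump_deg bump_poly * bump_poly.

Lemma size_kernel_poly : (size kernel_poly <= (2 * bump_deg).+1)%N.
Proof.
apply: leq_trans (size_polyMleq _ _) _.
have := size_poly bump_deg.+1 (fun i => (bump_poly`_(bump_deg - i))^*%R).
by rewrite -/(conj_rev _ _); have := size_bump; lia.
Qed.

Lemma kernelE y : circle y ->
  (jackson_kernel y)%:C%C = y ^- bump_deg * kernel_poly.[y] / jackson_mass%:C%C.
Proof.
move=> hy; rewrite rmorphM fmorphV /= -conjC_mul hornerM conj_rev_horner ?size_bump//.
by rewrite mulrA mulKf ?expf_neq0 ?circle_neq0// [_^*%R * _]mulrC.
Qed.

(** The kernel is a trigonometric polynomial of degree at most [bump_deg], hence orthogonal to
    larger frequencies; the second hypothesis excludes aliasing modulo [L]. *)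
Lemma kernel_freq (e : int) : (bump_deg < `|e|)%N -> (`|e| + bump_deg < L)%N ->
  \sum_(j < L) (jackson_kernel (z ^+ j))%:C%C * (z ^+ j) ^ e = 0.
Proof.
move=> he1 he2.
transitivity (\sum_(b < (2 * bump_deg).+1) kernel_poly`_b / jackson_mass%:C%C *
   \sum_(j < L) (z ^+ j) ^ (e - bump_deg%:Z + b%:Z)).
  under [RHS]eq_bigr do rewrite mulr_sumr.
  rewrite [RHS]exchange_big; apply: eq_bigr => j _.
  rewrite kernelE// (horner_coef_wide _ size_kernel_poly) mulr_sumr !mulr_suml.
  apply: eq_bigr => b _; rewrite !expfzDr ?circle_neq0//.
  by rewrite -exprnN -[_ ^ b]exprnP; ring.
rewrite big1// => b _; rewrite (prim_root_sum hz) ?ifN ?mulr0//.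
  by case: b => b /= hb; lia.
by case: b => b /= hb; lia.
Qed.

End Grid.
End Kernel.

(** * Approximation by trigonometric polynomials *)

Section Jackson.
Variable R : realType.
Local Notation C := (Cplx R).

(** A trigonometric polynomial is stored as an ordinary polynomial and a shift: the coefficient of
    index [i] has frequency [i - d]. *)
Definition laurent d (p : {poly C}) (z : C) : C := z ^- d * p.[z].

Lemma laurentE n d (p : {poly C}) z : (size p <= n)%N -> z != 0 ->
  laurent d p z = \sum_(i < n) p`_i * z ^ (i%:Z - d%:Z).
Proof.
move=> hp z0; rewrite /laurent (horner_coef_wide _ hp) mulr_sumr.
apply: eq_bigr => i _; rewrite expfzDr// mulrCA [_ ^ i * _]mulrC.
by rewrite -exprnP -exprnN.
Qed.

(** [Delta t] is diagonal on monomials: it multiplies [z^e] by [t^e - 1]. *)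
Lemma iter_Delta_laurent n d (p : {poly C}) k t z : (size p <= n)%N ->
  circle t -> circle z ->
  iter k (Delta t) (laurent d p) z =
  \sum_(i < n) p`_i * (t ^ (i%:Z - d%:Z) - 1) ^+ k * z ^ (i%:Z - d%:Z).
Proof.
move=> hp ht; elim: k z => [|k IH] z hz.
  by rewrite /= (laurentE _ hp) ?circle_neq0//; apply: eq_bigr => i _; rewrite expr0 mulr1.
rewrite iterS /Delta !IH//; last exact: circleM.
rewrite -sumrB; apply: eq_bigr => i _; rewrite expfzMl exprS; ring.
Qed.

Lemma iter_Delta_dist k t e (F G : C -> C) :
  circle t -> (forall z, circle z -> rnorm (F z - G z) <= e) ->
  forall z, circle z ->
  rnorm (iter k (Delta t) F z - iter k (Delta t) G z) <= 2 ^+ k * e.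
Proof.
move=> ht h; elim: k => [|k IH] z hz; first by rewrite mul1r h.
rewrite !iterS /Delta opprD opprK addrACA [X in _ + X]addrC.
rewrite exprS -mulrA mulr_natl mulr2n.
apply: le_trans (ler_rnormD _ _) _; apply: lerD; first exact/IH/circleM.
by rewrite rdistC IH.
Qed.

(* [p'] is [p - (-1)^m] times the average of [Delta_t^m p] in [t] against the
   jackson_kernel; the average kills every frequency that, once multiplied by some
   [0 < k <= m], is beyond the degree of the kernel. *)
Lemma jackson m N d (p : {poly C}) : (0 < N)%N -> (size p <= (2 * d).+1)%N ->
  exists2 p' : {poly C}, (size p' <= (2 * d).+1)%N /\
    (forall i : nat, p'`_i != 0 -> (`|i%:Z - d%:Z| <= m.+1 * N.-1)%N) &
  forall a b : R, 0 <= a ->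
    (forall t z, circle t -> circle z -> rnorm (iter m (Delta t) (laurent d p) z)
       <= a * (1 + (N%:R * rnorm (1 - t)) ^+ (2 * m)) + b) ->
  forall z, circle z ->
    rnorm (laurent d p z - laurent d p' z) <= a * (1 + m.+1%:R * 4 ^+ m) + b.
Proof.
(* The frequencies that occur are [k (i - d)] with [k <= m] and [|i - d| <= d]; together with the
   degree of the kernel they stay below [L]. *)
move=> N0 hp; pose L := (m * d + m.+1 * N).+1.
have [z hz] := closed_prim_root C (ltn0Sn (m * d + m.+1 * N)).
have NL : (m.+1 * N <= L)%N by rewrite /L; lia.
pose ker j := jackson_kernel L m N (z ^+ j).
have ker1 : \sum_(j < L) ker j = 1.
  rewrite -[RHS](@kernel_sum R L z hz m N N0 NL 1); last by rewrite /circle /= normr1.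
  by apply: eq_bigr => j _; rewrite mul1r.
have ker1C : \sum_(j < L) (ker j)%:C%C = 1 :> C by rewrite -rmorph_sum ker1.
(* The average of [Delta_t^m] multiplies frequency [i - d] by [c i]. *)
pose c (i : nat) : C := \sum_(j < L) (ker j)%:C%C * ((z ^+ j) ^ (i%:Z - d%:Z) - 1) ^+ m.
pose p' := \poly_(i < (2 * d).+1) (p`_i * (1 - (-1) ^+ m * c i)).
have zj j : circle (z ^+ j) by apply: circleX (prim_root_circle hz).
exists p'; first split; first exact: size_poly.
  move=> i; rewrite coef_poly; case: ltnP => hi; last by rewrite eqxx.
  apply: contraNT; rewrite -ltnNge => hD.
  suff -> : c i = (-1) ^+ m by rewrite -exprD addnn -mul2n exprM sqrrN expr1n expr1n subrr mulr0.
  transitivity (\sum_(k < m.+1) (-1) ^+ (m - k) * 'C(m, k)%:R *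
      \sum_(j < L) (ker j)%:C%C * (z ^+ j) ^ ((i%:Z - d%:Z) * k%:Z)).
    rewrite /c; under [RHS]eq_bigr do rewrite mulr_sumr.
    rewrite [RHS]exchange_big; apply: eq_bigr => j _.
    rewrite addrC exprDn mulr_sumr; apply: eq_bigr => k _.
    by rewrite -exprz_exp -exprnP -mulr_natr; ring.
  (* Only [k = 0] survives, and there the kernel sums to 1; so [c i = (-1)^m], which makes the
     multiplier of [p'] vanish. *)
  rewrite big_ord_recl [X in _ + X]big1 ?addr0 => [|k _].
    rewrite subn0 bin0 mulr1.
    transitivity ((-1) ^+ m * (\sum_(j < L) (ker j)%:C%C : C)); last by rewrite ker1C mulr1.
    congr (_ * _); apply: eq_bigr => j _; by rewrite mulr0 expr0z mulr1.
  rewrite /ker kernel_freq ?mulr0//= /bump_deg /bump/=; first by case: k => k /= hk; nia.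
  by case: k => k /= hk; rewrite /L; nia.
move=> a b a0 hab y hy.
have -> : laurent d p y - laurent d p' y =
    (-1) ^+ m * \sum_(j < L) (ker j)%:C%C * iter m (Delta (z ^+ j)) (laurent d p) y.
  rewrite (laurentE _ hp) ?circle_neq0// (laurentE _ (size_poly _ _)) ?circle_neq0//.
  under [X in _ = _ * X]eq_bigr do rewrite (iter_Delta_laurent d m hp)// mulr_sumr.
  rewrite exchange_big mulr_sumr -sumrB; apply: eq_bigr => i _ /=.
  rewrite coef_poly ltn_ord.
  transitivity ((-1) ^+ m * (c i * p`_i * y ^ (i%:Z - d%:Z))); first by ring.
  by rewrite /c !mulr_suml; congr (_ * _); apply: eq_bigr => j _; ring.
rewrite rnormM rnormX rnormN rnorm1 expr1n mul1r.
apply: le_trans (rnorm_sum _ _ _) _.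
apply: le_trans (_ : \sum_(j < L) (a * (ker j + N%:R ^+ (2 * m) *
    (ker j * rnorm (1 - z ^+ j) ^+ (2 * m))) + ker j * b) <= _).
  apply: ler_sum => j _; rewrite rnormM.
  have k0 : 0 <= ker j by exact: (kernel_ge0 hz N0 NL).
  have -> : rnorm ((ker j)%:C%C : C) = ker j by rewrite /rnorm ger0_norm// lecR.
  apply: le_trans (ler_wpM2l k0 (hab _ _ (zj j) hy)) _.
  by rewrite exprMn le_eqVlt; apply/orP; left; apply/eqP; ring.
rewrite big_split /= -mulr_sumr big_split /= -[X in _ + X <= _]mulr_suml ker1 mul1r -mulr_sumr.
rewrite lerD2r ler_wpM2l// lerD2l.
apply: le_trans (kernel_moment hz N0 NL (y := 1) _); last by rewrite /circle /= normr1.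
rewrite ler_wpM2l ?exprn_ge0// le_eqVlt; apply/orP; left; apply/eqP.
by apply: eq_bigr => j _; rewrite mul1r.
Qed.

(** Convolution of [f] with the kernel for [m = 1], sampled at roots of unity, is a trigonometric
    polynomial in [y]. Points [z^-j] within [r] of [y] cost [e / 2] by uniform continuity; at the
    others [2 M] is at most [2 M |y - z^-j|^2 / r^2], which the second moment makes small. *)
Lemma trig_dense (f : C -> C) M :
  (forall z, circle z -> rnorm (f z) <= M) ->
  (forall e : R, 0 < e -> exists2 r : R, 0 < r & forall z y, circle z -> circle y ->
     rnorm (z - y) < r -> rnorm (f z - f y) <= e) ->
  forall e : R, 0 < e -> exists d (p : {poly C}), (size p <= (2 * d).+1)%N /\
    forall z, circle z -> rnorm (f z - laurent d p z) <= e.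
Proof.
move=> hM hunif e e0.
have [r r0 hr] := hunif (e / 2) (divr_gt0 e0 (ltr0n _ 2)).
have M0 : 0 <= M by apply: le_trans (rnorm_ge0 _) (hM 1 _); rewrite /circle /= normr1.
(* The 8 is the bound of [kernel_moment] at [m = 1]. *)
pose A : R := 2 * M / r ^+ 2 * 8.
have A0 : 0 <= A by rewrite mulr_ge0 ?divr_ge0 ?exprn_ge0 ?mulr_ge0 ?(ltW r0).
pose N := (Num.Def.archi_bound (2 * A / e)).+1.
have hN : A <= e / 2 * N%:R ^+ 2.
  have : 2 * A / e < N%:R.
    apply: lt_le_trans (_ : (Num.Def.archi_bound (2 * A / e))%:R <= _); last by rewrite ler_nat.
    apply: archi_boundP; apply: divr_ge0; last exact: ltW. by apply: mulr_ge0.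
  rewrite ltr_pdivrMr//.
  have : 1 <= N%:R :> R by rewrite ler1n.
  nra.
pose L := (2 * N)%N.
have [z hz] := closed_prim_root C (ltn0Sn (2 * N).-1).
rewrite prednK ?muln_gt0// -/L in hz.
have NL : (2 * N <= L)%N by [].
have N0 : (0 < N)%N by [].
pose D := bump_deg 1 N.
have zj j : circle (z ^+ j) by apply: circleX (prim_root_circle hz).
pose Q : {poly C} := kernel_poly R 1 N.
(* The factors come from [kernelE] at [y * z ^+ j]; what remains, [y ^- D], is the shift of
   [laurent]. *)
pose c j : C := f (z ^- j) * (jackson_mass R L 1 N)^-1%:C%C * (z ^+ j) ^- D.
pose p : {poly C} := \sum_(j < L) c j *: (Q \Po (z ^+ j *: 'X)).
exists D, p; split.
  apply: (leq_trans (size_sum _ _ _)); apply/bigmax_leqP => j _.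
  apply: leq_trans (size_scale_leq _ _) _.
  apply: leq_trans (size_comp_poly_leq _ _) _.
  rewrite size_scale ?size_polyX ?muln1 ?circle_neq0//.
  by have := size_kernel_poly hz N0 NL; rewrite -/Q -/D; lia.
move=> y hy; pose ker (j : nat) : R := @jackson_kernel R L 1%N N (y * z ^+ j).
have cyz j : circle (y * z ^+ j) by apply: circleM.
have -> : laurent D p y = \sum_(j < L) (ker j)%:C%C * f (z ^- j).
  rewrite /laurent /p horner_sum mulr_sumr; apply: eq_bigr => j _.
  rewrite kernelE// hornerZ horner_comp hornerZ hornerX exprMn invfM /c fmorphV.
  rewrite [z ^+ j * y]mulrC -/D -/Q; ring.
have ker1 : \sum_(j < L) ker j = 1 by exact: kernel_sum.
have -> : f y - \sum_(j < L) (ker j)%:C%C * f (z ^- j) =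
    \sum_(j < L) (ker j)%:C%C * (f y - f (z ^- j)).
  under [RHS]eq_bigr do rewrite mulrBr.
  by rewrite sumrB -mulr_suml -rmorph_sum /= ker1 mul1r.
apply: le_trans (rnorm_sum _ _ _) _.
apply: le_trans (_ : \sum_(j < L) (e / 2 * ker j + 2 * M / r ^+ 2 *
    (ker j * rnorm (1 - y * z ^+ j) ^+ (2 * 1))) <= _).
  apply: ler_sum => j _; rewrite rnormM.
  have k0 : 0 <= ker j by exact: (kernel_ge0 hz N0 NL).
  have -> : rnorm ((ker j)%:C%C : C) = ker j by rewrite /rnorm ger0_norm// lecR.
  rewrite [_ * (ker j * _)]mulrCA [e / 2 * _]mulrC -mulrDr; apply: ler_wpM2l => //.
  have cz : circle (z ^- j) by apply: circleV.
  have e2 : rnorm (y - z ^- j) = rnorm (1 - y * z ^+ j).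
    rewrite -[LHS]mulr1 -((circleE (z ^+ j)).1 (zj j)) -rnormM mulrBl mulVf ?circle_neq0//.
    exact: rdistC.
  have [h|h] := ltP (rnorm (y - z ^- j)) r.
    apply: le_trans (hr _ _ hy cz h) _.
    by rewrite lerDl !mulr_ge0 ?invr_ge0 ?exprn_ge0 ?rnorm_ge0// ltW.
  apply: le_trans (_ : 2 * M <= _).
    apply: le_trans (ler_rnormB _ _) _; have := hM _ hy; have := hM _ cz; lra.
  apply: le_trans (_ : 2 * M / r ^+ 2 * rnorm (1 - y * z ^+ j) ^+ (2 * 1) <= _).
    rewrite mulrAC ler_pdivlMr ?exprn_gt0//; apply: ler_wpM2l; first by rewrite mulr_ge0.
    by rewrite muln1 -e2 lerXn2r ?nnegrE ?rnorm_ge0// ltW.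
  by rewrite lerDr divr_ge0// ltW.
rewrite big_split /= -!mulr_sumr ker1 mulr1.
have := kernel_moment hz N0 NL hy; rewrite -/ker.
set S := \sum_(j < L) _ => hS.
have Nn : 0 < N%:R ^+ 2 :> R by rewrite exprn_gt0// ltr0n.
have S2 : S <= 8 / N%:R ^+ 2 by rewrite ler_pdivlMr// mulrC; lra.
have : 2 * M / r ^+ 2 * S <= A / N%:R ^+ 2.
  rewrite /A -[X in _ <= X]mulrA ler_wpM2l ?divr_ge0 ?mulr_ge0 ?exprn_ge0 ?(ltW r0)//.
have : A / N%:R ^+ 2 <= e / 2 by rewrite ler_pdivrMr.
lra.
Qed.

(** With [l] minimal such that [N y <= 2^(l+1)], iterated doubling costs [2^(m(l+1))], and [2^(ml)]
    is at most 1 or [(N y)^m]. The exponent is relaxed from [m] to [2m] by [u <= 1 + u^2], to meet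
    [kernel_moment]. *)
Lemma doubling_bound m (w : R -> R) N y :
  (forall x, 0 < x -> 0 < w x) ->
  (forall x y, 0 < x -> x <= y -> w x <= w y) ->
  (forall x, 0 < x -> w (2 * x) <= 2 ^+ m * w x) ->
  (0 < N)%N -> 0 < y ->
  w y <= 2 ^+ m * w N%:R^-1 * (1 + (N%:R * y) ^+ (2 * m)).
Proof.
move=> w0 wmon wdbl N0 y0.
have Ni : 0 < N%:R^-1 :> R by rewrite invr_gt0 ltr0n.
have wN := w0 _ Ni.
have witer l x : 0 < x -> w (2 ^+ l * x) <= 2 ^+ (m * l) * w x.
  move=> x0; elim: l => [|l IH]; first by rewrite muln0 !expr0 !mul1r.
  rewrite exprS -mulrA; apply: le_trans (wdbl _ _) _; first by rewrite mulr_gt0 ?exprn_gt0.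
  by rewrite mulnS exprD -mulrA ler_wpM2l ?exprn_ge0.
have [l hl1 hl2] : exists2 l : nat, N%:R * y <= 2 ^+ l.+1 & 2 ^+ (m * l) <= 1 + (N%:R * y) ^+ (2 * m).
  have ex : exists l : nat, N%:R * y <= 2 ^+ l.+1.
    exists (Num.Def.archi_bound (N%:R * y)).
    apply: ltW; exact: upper_nthrootP.
  have Ny : 0 < N%:R * y by rewrite mulr_gt0 ?ltr0n.
  case: (ex_minnP ex) => -[|l] hl hmin.
    by exists 0%N => //; rewrite muln0 lerDl exprn_ge0// ltW.
  exists l.+1 => //.
  have h : 2 ^+ l.+1 <= N%:R * y.
    by rewrite leNgt; apply/negP => /ltW /hmin; rewrite ltnn.
  rewrite mulnC exprM; apply: le_trans (_ : (N%:R * y) ^+ m <= _).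
    by rewrite lerXn2r ?nnegrE ?exprn_ge0// ltW.
  rewrite mulnC exprM; set u := _ ^+ m.
  have := sqr_ge0 (u - 1); have : 0 <= u by rewrite exprn_ge0// ltW.
  nra.
have hy : y <= 2 ^+ l.+1 * N%:R^-1 by rewrite ler_pdivlMr ?ltr0n// mulrC.
apply: le_trans (wmon _ _ y0 hy) _.
apply: le_trans (witer _ _ Ni) _.
rewrite mulnS exprD [X in _ <= X]mulrAC; apply: ler_wpM2r; first exact: ltW.
by rewrite ler_wpM2l ?exprn_ge0.
Qed.

End Jackson.

(** * Exponentials of bounded operators *)

Section Completeness.
Variables (R : realType) (H : completeNormedModType (Cplx R)).

Lemma rnorm_cauchy_lim (u : nat -> H) :
  (forall e : R, 0 < e -> exists N, forall n, (N <= n)%N -> rnorm (u n - u N) <= e) ->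
  forall e : R, 0 < e -> exists N, forall n, (N <= n)%N -> rnorm (u n - limn u) <= e.
Proof.
move=> hu.
have realE (e : Cplx R) : 0 < e -> exists2 r : R, 0 < r & e = r%:C%C.
  move=> e0; exists (complex.Re e); last by rewrite [LHS]complexE (ger0_Im (ltW e0)) mulr0 addr0.
  by have := e0; rewrite [e in 0 < e]complexE (ger0_Im (ltW e0)) mulr0 addr0 ltcR.
have cu : cvgn u.
  apply: cauchy_cvg; apply: cauchy_exP => e /realE[r r0 ->].
  have [N hN] := hu (r / 2) (divr_gt0 r0 (ltr0n _ 2)).
  exists (u N); exists N => // n /= hn.
  rewrite -ball_normE /= distrC rnormE ltcR.
  by apply: le_lt_trans (hN n hn) _; lra.
move=> e e0; move/cvgrPdist_le: cu => /(_ e%:C%C); rewrite ltcR => /(_ e0)[N _ hN].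
by exists N => n /hN /=; rewrite distrC rnormE lecR.
Qed.

End Completeness.

Section ExpPoly.

Definition exp_poly (F : fieldType) n (c : F) : {poly F} := \poly_(k < n) (c ^+ k / k`!%:R).

Lemma exp_term_binomial (F : numFieldType) (c d : F) k :
  \sum_(i < k.+1) (c ^+ i / i`!%:R) * (d ^+ (k - i) / (k - i)`!%:R) =
  (c + d) ^+ k / k`!%:R.
Proof.
rewrite [c + d]addrC exprDn mulr_suml; apply: eq_bigr => i _.
have hi : (i <= k)%N by rewrite -ltnS.
have nz n : n`!%:R != 0 :> F by rewrite pnatr_eq0 -lt0n fact_gt0.
rewrite -mulr_natr; have := bin_fact hi => /(congr1 (fun n : nat => n%:R : F)).
rewrite !natrM => e; have -> : k`!%:R = 'C(k, i)%:R * (i`!%:R * (k - i)`!%:R) :> F by [].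
have hb : 'C(k, i)%:R != 0 :> F by rewrite pnatr_eq0 -lt0n bin_gt0.
by field; rewrite hb !nz.
Qed.

Variable R : realType.
Local Notation C := (Cplx R).

Lemma coef_exp_polyM n (F : numFieldType) (c d : F) k : (k < n)%N ->
  (exp_poly n c * exp_poly n d - exp_poly n (c + d))`_k = 0.
Proof.
move=> kn; rewrite coefB coefM coef_poly kn -exp_term_binomial -sumrB big1// => i _.
have hi : (i <= k)%N by rewrite -ltnS.
by rewrite !coef_poly (leq_ltn_trans hi kn) (leq_ltn_trans (leq_subr i k) kn) subrr.
Qed.

(** Below degree [n] the Cauchy product is exact; from there on each coefficient is a sum of
    monomials in [c] and [d] with nonnegative weights. The operator error is thus majorised by the
    scalar one at [|c|] and [|d|]. *)
Lemma coef_exp_polyM_le n (c d : C) k :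
  rnorm (exp_poly n c * exp_poly n d - exp_poly n (c + d))`_k <=
  (exp_poly n (rnorm c) * exp_poly n (rnorm d) - exp_poly n (rnorm c + rnorm d))`_k.
Proof.
have [kn|nk] := ltnP k n; first by rewrite !coef_exp_polyM// rnorm0.
rewrite !coefB ![(exp_poly _ (_ + _))`_k]coef_poly ltnNge nk /= !subr0 !coefM.
apply: le_trans (rnorm_sum _ _ _) _; apply: ler_sum => i _.
have h j (x : C) : rnorm (exp_poly n x)`_j = (exp_poly n (rnorm x))`_j.
  rewrite !coef_poly; case: ifP => _; last exact: rnorm0.
  by rewrite rnormM rnormX rnormV rnorm_nat.
by rewrite rnormM !h.
Qed.

Lemma exp_poly_horner (y a : R) n : (exp_poly n y).[a] = series (exp_coeff (y * a)) n.
Proof.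
rewrite horner_poly /series /= big_mkord; apply: eq_bigr => k _.
by rewrite /exp_coeff /= exprMn mulrAC.
Qed.

Lemma exp_series_le (y : R) n : 0 <= y -> series (exp_coeff y) n <= expR y.
Proof.
move=> y0; rewrite /expR; apply: nondecreasing_cvgn_le (is_cvg_series_exp_coeff y) n.
apply/nondecreasing_seqP => n; rewrite /series /= big_nat_recr//= lerDl.
by rewrite /exp_coeff /= divr_ge0// exprn_ge0.
Qed.

Lemma exp_series_cvg (y e : R) : 0 < e ->
  exists N, forall n, (N <= n)%N -> `|expR y - series (exp_coeff y) n| <= e.
Proof.
move=> e0; have := is_cvg_series_exp_coeff y; rewrite -[in limn _]/(expR y).
by move=> /cvgrPdist_le /(_ e e0) [N _ hN]; exists N => n /hN.
Qed.

End ExpPoly.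

Section Exponential.
Variables (R : realType) (H : completeNormedModType (Cplx R)).
Local Notation C := (Cplx R).
Variables (A : {linear H -> H}) (a : R).
Hypothesis a_ge0 : 0 <= a.
Hypothesis hA : forall x, rnorm (A x) <= a * rnorm x.

Lemma iter_bounded n x : rnorm (iter n A x) <= a ^+ n * rnorm x.
Proof.
elim: n => [|n IH]; first by rewrite mul1r.
by rewrite iterS exprS -mulrA (le_trans (hA _))// ler_wpM2l.
Qed.

Lemma iter_scale (c : C) n x :
  iter n (c *: (A : H -> H)) x = c ^+ n *: iter n A x.
Proof.
elim: n => [|n IH]; first by rewrite scale1r.
by rewrite !iterS IH fctE linearZ scalerA exprS.
Qed.

Lemma exp_partial (c : C) n x :
  series (fun k => (k`!%:R : C)^-1 *: iter k (c *: (A : H -> H)) x) n =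
  pev (exp_poly n c) A x.
Proof.
rewrite (pev_wide _ _ (size_poly _ _)) /series /= big_mkord.
by apply: eq_bigr => k _; rewrite iter_scale scalerA coef_poly ltn_ord mulrC.
Qed.

Lemma exp_partial_dist (c : C) N n x : (N <= n)%N ->
  rnorm (pev (exp_poly n c) A x - pev (exp_poly N c) A x) <=
  (series (exp_coeff (rnorm c * a)) n - series (exp_coeff (rnorm c * a)) N) * rnorm x.
Proof.
move=> hN; rewrite -!exp_partial sub_series_geq// sub_series_geq// mulr_suml.
apply: le_trans (rnorm_sum _ _ _) _; apply: ler_sum => k _.
rewrite iter_scale scalerA rnormZ rnormM rnormV rnorm_nat rnormX /exp_coeff /=.
have -> : (rnorm c * a) ^+ k / k`!%:R * rnorm x =
    k`!%:R^-1 * rnorm c ^+ k * (a ^+ k * rnorm x) by rewrite exprMn; ring.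
by rewrite ler_wpM2l ?iter_bounded// mulr_ge0 ?invr_ge0 ?exprn_ge0 ?rnorm_ge0.
Qed.

(** The scalar exponential series at [|c| a] is a majorant. The cases [n = 0] and [n = 1] give
    [expop_bound] and [expop_near_id]. *)
Lemma expop_tail (c : C) n x :
  rnorm (pev (exp_poly n c) A x - expop (c *: (A : H -> H)) x) <=
  (expR (rnorm c * a) - series (exp_coeff (rnorm c * a)) n) * rnorm x.
Proof.
have ca : 0 <= rnorm c * a by rewrite mulr_ge0 ?rnorm_ge0.
set y := rnorm c * a in ca *.
pose u n := pev (exp_poly n c) A x.
have uE : u = series (fun k => (k`!%:R : C)^-1 *: iter k (c *: (A : H -> H)) x).
  by apply/funext => k; rewrite exp_partial.
have hd N k : (N <= k)%N -> rnorm (u k - u N) <= (expR y - series (exp_coeff y) N) * rnorm x.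
  move=> hN; apply: le_trans (exp_partial_dist c x hN) _.
  by rewrite ler_wpM2r ?rnorm_ge0// lerD2r exp_series_le.
have lim := @rnorm_cauchy_lim R H u.
rewrite /expop -uE.
apply/ler_addgt0Pl => e e0; have {}[] := lim _ e e0.
  move=> {}e {}e0; have [N hN] := exp_series_cvg y (divr_gt0 e0 (ltr_wpDl (rnorm_ge0 x) ltr01)).
  exists N => k hk; apply: le_trans (hd _ _ hk) _.
  apply: le_trans (ler_wpM2r (rnorm_ge0 x) (le_trans (ler_norm _) (hN N (leqnn N)))) _.
  rewrite mulrAC ler_pdivrMr ?ltr_wpDl ?rnorm_ge0// ler_wpM2l ?(ltW e0)//; lra.
move=> N hN.
rewrite -(subrKA (u (maxn n N))); apply: le_trans (ler_rnormD _ _) _.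
rewrite addrC; apply: lerD; first exact/hN/leq_maxr.
by rewrite rdistC hd// leq_maxl.
Qed.

Lemma expop_approx (c : C) x e : 0 < e -> exists N, forall n, (N <= n)%N ->
  rnorm (pev (exp_poly n c) A x - expop (c *: (A : H -> H)) x) <= e.
Proof.
move=> e0; have [N hN] := exp_series_cvg (rnorm c * a) (divr_gt0 e0 (ltr_wpDl (rnorm_ge0 x) ltr01)).
exists N => n hn; apply: le_trans (expop_tail _ _ _) _.
apply: le_trans (ler_wpM2r (rnorm_ge0 x) (le_trans (ler_norm _) (hN n hn))) _.
rewrite mulrAC ler_pdivrMr ?ltr_wpDl ?rnorm_ge0// ler_wpM2l ?(ltW e0)//; lra.
Qed.

Lemma rnorm_small0 (V : normedModType C) (x : V) (K : R) :
  (forall e : R, 0 < e -> rnorm x <= K * e) -> x = 0.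
Proof.
move=> h; apply/eqP; rewrite -rnorm_eq0 eq_le rnorm_ge0 andbT.
have K0 : 0 <= K by have := le_trans (rnorm_ge0 x) (h 1 ltr01); rewrite mulr1.
apply/ler_addgt0Pl => e e0; rewrite addr0.
have K1 : 0 < K + 1 by lra.
apply: le_trans (h _ (divr_gt0 e0 K1)) _; rewrite mulrA ler_pdivrMr// mulrC.
by rewrite ler_wpM2l ?(ltW e0)//; lra.
Qed.

Lemma expop_linear (c : C) : linear (expop (c *: (A : H -> H))).
Proof.
move=> k x y; apply/eqP; rewrite -subr_eq0; apply/eqP.
apply: (@rnorm_small0 _ _ (1 + rnorm k + 1)) => e e0.
have [N1 h1] := expop_approx c x e0; have [N2 h2] := expop_approx c y e0.
have [N3 h3] := expop_approx c (k *: x + y) e0.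
pose n := maxn N1 (maxn N2 N3).
have {}h1 := h1 n (leq_maxl _ _).
have {}h2 := h2 n (leq_trans (leq_maxl _ _) (leq_maxr _ _)).
have {}h3 := h3 n (leq_trans (leq_maxr _ _) (leq_maxr _ _)).
move: h1 h2 h3; rewrite pevDx pevZx.
move: (pev (exp_poly n c) A x) (pev (exp_poly n c) A y) => p q.
move: (expop _ (k *: x + y)) (expop (c *: (A : H -> H)) x) (expop (c *: (A : H -> H)) y).
move=> exy ex ey h1 h2 h3.
have -> : exy - (k *: ex + ey) = - (k *: p + q - exy) + k *: (p - ex) + (q - ey).
  rewrite opprB scalerBr -[RHS]addrA [X in _ = _ + X]addrACA.
  by rewrite [RHS]addrA subrK opprD.
apply: le_trans (ler_rnormD _ _) _; rewrite !mulrDl !mul1r; apply: lerD => //.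
apply: le_trans (ler_rnormD _ _) _; apply: lerD; first by rewrite rnormN.
by rewrite rnormZ ler_wpM2l ?rnorm_ge0.
Qed.

Lemma pev_bound (p : {poly C}) (q : {poly R}) x :
  (forall k, rnorm p`_k <= q`_k) -> rnorm (pev p A x) <= q.[a] * rnorm x.
Proof.
move=> h; have sz : (size p <= maxn (size p) (size q))%N by exact: leq_maxl.
rewrite (pev_wide _ _ sz) (horner_coef_wide _ (leq_maxr (size p) (size q))) mulr_suml.
apply: le_trans (rnorm_sum _ _ _) _; apply: ler_sum => k _; rewrite rnormZ -mulrA.
by rewrite ler_pM ?rnorm_ge0 ?iter_bounded.
Qed.

Lemma expop_bound (c : C) x :
  rnorm (expop (c *: (A : H -> H)) x) <= expR (rnorm c * a) * rnorm x.
Proof.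
have := expop_tail c 0 x; rewrite /exp_poly poly_def big_ord0 pev0 sub0r rnormN.
by rewrite /series /= big_geq// subr0.
Qed.

(** Passes through the truncation [q] of [e^(dA) x]. The third of the four errors compares a product
    of truncations with the truncation for [c + d], by [coef_exp_polyM_le] and the scalar identity
    [expRD]. *)
Lemma expopD (c d : C) x :
  expop ((c + d) *: (A : H -> H)) x =
  expop (c *: (A : H -> H)) (expop (d *: (A : H -> H)) x).
Proof.
apply/eqP; rewrite eq_sym -subr_eq0; apply/eqP.
apply: (@rnorm_small0 _ _ (expR (rnorm c * a) + expR (rnorm d * a) * rnorm x
  + rnorm x + 1)) => e e0.
have [N1 h1] := expop_approx d x e0.
have [N2 h2] := exp_series_cvg (rnorm c * a) e0.
have [N3 h3] := exp_series_cvg ((rnorm c + rnorm d) * a) e0.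
have [N4 h4] := expop_approx (c + d) x e0.
pose n := maxn (maxn N1 N2) (maxn N3 N4).
have {}h1 := h1 n (leq_trans (leq_maxl _ _) (leq_maxl _ _)).
have {}h2 := le_trans (ler_norm _) (h2 n (leq_trans (leq_maxr _ _) (leq_maxl _ _))).
have {}h3 := le_trans (ler_norm _) (h3 n (leq_trans (leq_maxl _ _) (leq_maxr _ _))).
have {}h4 := h4 n (leq_trans (leq_maxr _ _) (leq_maxr _ _)).
pose Wl : {linear H -> H} := HB.pack (expop (c *: (A : H -> H)))
  (GRing.isLinear.Build _ _ _ _ _ (expop_linear c)).
have WE z : expop (c *: (A : H -> H)) z = Wl z by [].
set q := pev (exp_poly n d) A x in h1; rewrite rdistC in h1.
have -> : expop (c *: (A : H -> H)) (expop (d *: (A : H -> H)) x) -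
    expop ((c + d) *: (A : H -> H)) x =
  expop (c *: (A : H -> H)) (expop (d *: (A : H -> H)) x - q) +
  (expop (c *: (A : H -> H)) q - pev (exp_poly n c) A q) +
  (pev (exp_poly n c) A q - pev (exp_poly n (c + d)) A x) +
  (pev (exp_poly n (c + d)) A x - expop ((c + d) *: (A : H -> H)) x).
  by rewrite !WE linearB !addrA !subrK.
have t1 := le_trans (expop_bound c _) (ler_wpM2l (expR_ge0 (rnorm c * a)) h1).
have hq : rnorm q <= expR (rnorm d * a) * rnorm x.
  apply: le_trans (pev_bound (q := exp_poly n (rnorm d)) x _) _ => [k|].
    rewrite !coef_poly; case: ifP => _; last by rewrite rnorm0.
    by rewrite rnormM rnormX rnormV rnorm_nat.
  by rewrite exp_poly_horner ler_wpM2r ?rnorm_ge0// exp_series_le// mulr_ge0 ?rnorm_ge0.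
have t2 := le_trans (expop_tail c n q) (ler_pM _ (rnorm_ge0 _) h2 hq).
have {}t2 := t2 _; rewrite subr_ge0 exp_series_le ?mulr_ge0 ?rnorm_ge0// in t2.
have {}t2 := t2 isT.
have t3 : rnorm (pev (exp_poly n c) A q - pev (exp_poly n (c + d)) A x) <= e * rnorm x.
  rewrite /q -pevM -pevB; apply: le_trans (pev_bound x (coef_exp_polyM_le n c d)) _.
  rewrite ler_wpM2r ?rnorm_ge0// hornerD hornerN hornerM !exp_poly_horner.
  apply: le_trans h3; rewrite lerD2r mulrDl expRD.
  by apply: ler_pM; rewrite ?exp_series_le ?mulr_ge0 ?rnorm_ge0// /series /= sumr_ge0// => k _;
    rewrite /exp_coeff /= divr_ge0// exprn_ge0// mulr_ge0 ?rnorm_ge0.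
rewrite rdistC in t2.
have := ler_rnormD (expop (c *: (A : H -> H)) (expop (d *: (A : H -> H)) x - q) +
  (expop (c *: (A : H -> H)) q - pev (exp_poly n c) A q) +
  (pev (exp_poly n c) A q - pev (exp_poly n (c + d)) A x))
  (pev (exp_poly n (c + d)) A x - expop ((c + d) *: (A : H -> H)) x).
move/le_trans; apply; rewrite 3!mulrDl mul1r; apply: lerD => //.
apply: le_trans (ler_rnormD _ _) _; rewrite [rnorm x * e]mulrC; apply: lerD => //.
by apply: le_trans (ler_rnormD _ _) _; apply: lerD => //; rewrite [_ * e]mulrC.
Qed.

Lemma expop_near_id (c : C) x :
  rnorm (expop (c *: (A : H -> H)) x - x) <= (expR (rnorm c * a) - 1) * rnorm x.
Proof.
have := expop_tail c 1 x; rewrite rdistC.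
rewrite /exp_poly poly_def big_ord1 expr0 fact0 divr1 scale1r expr0 -[1]/(1%:P) pevC scale1r.
by rewrite /series /= big_nat1 /exp_coeff /= expr0 fact0 divr1.
Qed.

Lemma expop0 x : expop ((0 : C) *: (A : H -> H)) x = x.
Proof.
apply/eqP; rewrite -subr_eq0 -rnorm_eq0 eq_le rnorm_ge0 andbT.
by apply: le_trans (expop_near_id _ _) _; rewrite rnorm0 mul0r expR0 subrr mul0r.
Qed.

Lemma expop_adjoint (dot : {dot H for Num.conj}) (c : C) :
  (forall x : H, `|x| ^+ 2 = dot x x) -> self_adjoint dot A ->
  is_adjoint dot (expop (c *: (A : H -> H))) (expop (c^*%R *: (A : H -> H))).
Proof.
move=> hdot sA x y; apply/eqP; rewrite -subr_eq0; apply/eqP.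
apply: (@rnorm_small0 _ _ (rnorm y + rnorm x)) => e e0.
have [N1 h1] := expop_approx c x e0; have [N2 h2] := expop_approx c^*%R y e0.
pose n := maxn N1 N2.
have {}h1 := h1 n (leq_maxl _ _); have {}h2 := h2 n (leq_maxr _ _).
have e1 : dot (pev (exp_poly n c) A x) y = dot x (pev (exp_poly n c^*%R) A y).
  rewrite !(pev_wide _ _ (size_poly _ _)) linear_sumlz linear_sumr.
  apply: eq_bigr => k _; rewrite linearZl linearZr /= !coef_poly ltn_ord.
  rewrite rmorphM fmorphV rmorphXn rmorph_nat /= conjCK; congr (_ * _).
  by elim: (nat_of_ord k) x y {h1 h2} => // j IH u v; rewrite iterS sA IH -iterSr.
have -> : dot (expop (c *: (A : H -> H)) x) y - dot x (expop (c^*%R *: (A : H -> H)) y) =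
  dot (expop (c *: (A : H -> H)) x - pev (exp_poly n c) A x) y +
  dot x (pev (exp_poly n c^*%R) A y - expop (c^*%R *: (A : H -> H)) y).
  by rewrite linearBl linearBr /= e1 addrA subrK.
apply: le_trans (ler_rnormD _ _) _; rewrite mulrDl; apply: lerD.
  apply: le_trans (cauchy_schwarz hdot _ _) _.
  by rewrite mulrC ler_wpM2l ?rnorm_ge0// rdistC.
apply: le_trans (cauchy_schwarz hdot _ _) _.
by rewrite ler_wpM2l ?rnorm_ge0.
Qed.

End Exponential.

(** * The Bernstein inequality for operators *)

Section ExpType.
Variables (R : realType) (H : normedModType (Cplx R)).
Local Notation C := (Cplx R).
Implicit Types (G : R -> H) (s c e : R).

Lemma exp_type_cst s (x : H) : 0 <= s -> exp_type s (rnorm x) (fun=> x).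
Proof.
move=> s0; elim=> [|j _] t; first by rewrite expr0 mulr1.
have -> : iter j.+1 (@fdiff R H) (fun=> x) = iter j (@fdiff R H) (0 *: 0).
  by rewrite iterSr; congr (iter _ _ _); apply/funext => u; rewrite /fdiff subrr scale0r.
by rewrite iter_fdiffZ scale0r rnorm0 mulr_ge0 ?rnorm_ge0 ?exprn_ge0.
Qed.

Lemma exp_type_le s s' c G : 0 <= s -> s <= s' -> 0 <= c ->
  exp_type s c G -> exp_type s' c G.
Proof.
move=> s0 ss c0 hG j t; apply: le_trans (hG j t) _.
by rewrite ler_wpM2l// lerXn2r ?nnegrE// (le_trans s0).
Qed.

Lemma exp_type_comp s c G (T : {linear H -> H}) :
  (forall x, rnorm (T x) <= rnorm x) -> exp_type s c G -> exp_type s c (T \o G).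
Proof.
move=> hT hG j t; have -> : iter j (@fdiff R H) (T \o G) = T \o iter j (@fdiff R H) G.
  elim: j => // j; rewrite !iterS => ->; apply/funext => u.
  by rewrite /fdiff /= linearB.
exact: le_trans (hT _) (hG j t).
Qed.

(** A Leibniz rule: with [B = W 1 - 1], the unit difference of [W t (G t)] is [W t] applied to
    [B (G (t + 1)) + fdiff G t]. Powers of [B] accumulate next to [G], hence the exponent [i] in the
    induction. *)
Lemma exp_type_group s c e G (W : R -> {linear H -> H}) : 0 <= e -> 0 <= s -> 0 <= c ->
  (forall t u x, W (t + u) x = W t (W u x)) ->
  (forall t x, rnorm (W t x) = rnorm x) ->
  (forall x, rnorm (W 1 x - x) <= e * rnorm x) ->
  exp_type s c G -> exp_type (e + s) c (fun t => W t (G t)).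
Proof.
move=> e0 s0 c0 WD Wiso We hG.
pose B x := W 1 x - x.
have BB n x y : iter n B (x - y) = iter n B x - iter n B y.
  elim: n => //= n ->; rewrite /B linearB /= !opprB !addrA.
  by rewrite [LHS]addrAC -!addrA; congr (_ + _); rewrite addrCA; congr (_ + _); rewrite addrC.
have Bn n x : rnorm (iter n B x) <= e ^+ n * rnorm x.
  elim: n => [|n IH]; first by rewrite mul1r.
  by rewrite iterS exprS -mulrA (le_trans (We _))// ler_wpM2l.
suff h j : forall i c G, 0 <= c -> exp_type s c G -> forall t,
    rnorm (iter j (@fdiff R H) (fun t => W t (iter i B (G t))) t) <= e ^+ i * c * (e + s) ^+ j.
  by move=> j t; have := h j 0%N c G c0 hG t; rewrite mul1r.
elim: j => [|j IH] i {hG}c {}G {}c0 hG t.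
  rewrite /= expr0 mulr1 Wiso (le_trans (Bn _ _))// ler_wpM2l ?exprn_ge0//.
  by have := hG 0%N t; rewrite expr0 mulr1.
have -> : iter j.+1 (@fdiff R H) (fun t => W t (iter i B (G t))) =
    iter j (@fdiff R H) (fun t => W t (iter i.+1 B (translate 1 G t))) +
    iter j (@fdiff R H) (fun t => W t (iter i B (fdiff G t))).
  rewrite -iter_fdiffD iterSr; congr (iter _ _ _); apply/funext => u.
  rewrite /fdiff /translate !fctE WD -linearB -linearD BB /= -/(B _); congr (W u _).
  by rewrite /B addrA subrK.
rewrite fctE; apply: le_trans (ler_rnormD _ _) _.
have h1 := IH i.+1 c _ c0 (exp_type_shift 1 hG) t.
have h2 := IH i _ _ (mulr_ge0 c0 s0) (exp_type_fdiff hG) t.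
apply: le_trans (lerD h1 h2) _.
by rewrite le_eqVlt !exprS; apply/orP; left; apply/eqP; ring.
Qed.

End ExpType.

Section OperatorBernstein.
Variables (R : realType).
Local Notation C := (Cplx R).
Variables (H : completeNormedModType C) (dot : {dot H for Num.conj}).
Hypothesis hdot : forall x : H, `|x| ^+ 2 = dot x x.

Definition laurent_op d (p : {poly C}) (V V' : H -> H) (x : H) : H :=
  iter d V' (pev p V x).

(** The integer power [V^(i-d)], with [V'] as the inverse of [V]. *)
Definition iter_signed (V V' : H -> H) d i x :=
  if (d <= i)%N then iter (i - d) V x else iter (d - i) V' x.

Lemma iter_cancel (V V' : H -> H) d i x : cancel V V' ->
  iter d V' (iter i V x) = iter_signed V V' d i x.
Proof.
move=> VK; have h n y : iter n V' (iter n V y) = y.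
  by elim: n => //= n IH; rewrite -[LHS]iterS iterSr VK.
rewrite /iter_signed; case: leqP => [/subnKC|/ltnW /subnKC] e.
  by rewrite -{1}e iterD h.
by rewrite -{1}e addnC iterD h.
Qed.

Lemma laurent_opE n d (p : {poly C}) (V V' : {linear H -> H}) x : cancel V V' ->
  (size p <= n)%N ->
  laurent_op d p V V' x = \sum_(i < n) p`_i *: iter_signed V V' d i x.
Proof.
move=> VK hp; rewrite /laurent_op (pev_wide _ _ hp).
have -> : iter d V' (\sum_(i < n) p`_i *: iter i V x) =
  \sum_(i < n) p`_i *: iter d V' (iter i V x).
  elim: d => //= d ->; rewrite linear_sum; apply: eq_bigr => i _.
  by rewrite linearZ.
by apply: eq_bigr => i _; rewrite iter_cancel.
Qed.

Lemma laurent_op_bound d p M (V V' : {linear H -> H}) x :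
  is_adjoint dot V V' -> cancel V V' -> cancel V' V ->
  (forall z, circle z -> rnorm (laurent d p z) <= M) ->
  rnorm (laurent_op d p V V' x) <= M * rnorm x.
Proof.
move=> aV VK V'K hM.
rewrite /laurent_op (iter_isometry _ _ (isometry_of_adjointV hdot aV VK V'K)).
apply: (von_neumann hdot aV VK V'K) => z hz.
have := hM z hz; rewrite /laurent rnormM rnormV rnormX (circleE z).1//.
by rewrite expr1n invr1 mul1r.
Qed.

Variables (W : R -> {linear H -> H}) (U U' : {linear H -> H}).
Hypothesis WD : forall t u x, W (t + u) x = W t (W u x).
Hypothesis W0 : forall x, W 0 x = x.
Hypothesis W_adj : forall t, is_adjoint dot (W t) (W (- t)).
Hypotheses (U_adj : is_adjoint dot U U') (UK : cancel U U') (U'K : cancel U' U).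

Let WK t : cancel (W t) (W (- t)).
Proof. by move=> x; rewrite -WD addNr W0. Qed.

Let W'K t : cancel (W (- t)) (W t).
Proof. by move=> x; rewrite -WD subrr W0. Qed.

Definition orbit_op t : {linear H -> H} := W t \o U.
Definition orbit_opV t : {linear H -> H} := U' \o W (- t).

Lemma orbit_adj t : is_adjoint dot (orbit_op t) (orbit_opV t).
Proof. by move=> x y; rewrite /= W_adj U_adj. Qed.

Lemma orbitK t : cancel (orbit_op t) (orbit_opV t).
Proof. by move=> x; rewrite /= WK UK. Qed.

Lemma orbitVK t : cancel (orbit_opV t) (orbit_op t).
Proof. by move=> x; rewrite /= U'K W'K. Qed.

Variable e : R.
Hypothesis e_ge0 : 0 <= e.
Hypothesis We : forall x, rnorm (W 1 x - x) <= e * rnorm x.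

Let Wiso t x : rnorm (W t x) = rnorm x.
Proof. exact: (isometry_of_adjoint hdot (W_adj t) (@WK t)). Qed.

(** [U] and [W t] are applied in turn: the isometry [U] keeps the type and every [W t] adds [e] to
    it. *)
Lemma exp_type_orbit n x : exp_type (e * n%:R) (rnorm x) (fun t => iter n (orbit_op t) x).
Proof.
elim: n => [|n IH]; first by rewrite mulr0; exact: exp_type_cst.
have Ule y : rnorm (U y) <= rnorm y by rewrite (isometry_of_adjoint hdot U_adj UK).
rewrite -addn1 natrD mulrDr mulr1 addrC addn1.
have h := exp_type_group e_ge0 (mulr_ge0 e_ge0 (ler0n _ n)) (rnorm_ge0 x) WD Wiso We.
exact: h (exp_type_comp Ule IH).
Qed.

(** Here [t] enters through [W (- t)], again a group of isometries. Its unit increment obeys the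
    same bound, as [W 1] maps [W (- 1) y - y] to [y - W 1 y]. *)
Lemma exp_type_orbitV n x : exp_type (e * n%:R) (rnorm x) (fun t => iter n (orbit_opV t) x).
Proof.
elim: n => [|n IH]; first by rewrite mulr0; exact: exp_type_cst.
have Ule y : rnorm (U' y) <= rnorm y by rewrite (isometry_of_adjointV hdot U_adj UK U'K).
rewrite -addn1 natrD mulrDr mulr1 addrC addn1.
pose W' t := W (- t).
have W'D t u y : W' (t + u) y = W' t (W' u y) by rewrite /W' opprD WD.
have W'iso t y : rnorm (W' t y) = rnorm y by exact: Wiso.
have W'e y : rnorm (W' 1 y - y) <= e * rnorm y.
  by rewrite -(Wiso 1) linearB /= W'K rdistC.
have h := exp_type_group e_ge0 (mulr_ge0 e_ge0 (ler0n _ n)) (rnorm_ge0 x) W'D W'iso W'e IH.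
exact: (exp_type_comp Ule h).
Qed.

(** The constant, from the triangle inequality over all coefficients, is crude, but it does not
    enter the conclusion of [bernstein]; what matters is the type [e D]. *)
Lemma exp_type_laurent d (p : {poly C}) D x :
  (forall i : nat, p`_i != 0 -> (`|i%:Z - d%:Z| <= D)%N) ->
  exp_type (e * D%:R) (\sum_(i < size p) rnorm p`_i * rnorm x)
    (fun t => laurent_op d p (orbit_op t) (orbit_opV t) x).
Proof.
move=> hD.
have -> : (fun t => laurent_op d p (orbit_op t) (orbit_opV t) x) =
    \sum_(i < size p) p`_i *: (fun t => iter_signed (orbit_op t) (orbit_opV t) d i x).
  apply/funext => t; rewrite (laurent_opE d x (@orbitK t) (leqnn _)) fct_sumE.
  exact: eq_bigr.
elim/big_ind2: _ => [|c1 G1 c2 G2|i _]; [exact: exp_type0|exact: exp_typeD|].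
have [->|hpi] := eqVneq p`_i 0.
  by rewrite scale0r rnorm0 mul0r; exact: exp_type0.
apply: exp_typeZ; have hi := hD i hpi.
have hle n : (n <= D)%N -> e * n%:R <= e * D%:R by move=> nD; rewrite ler_wpM2l// ler_nat.
rewrite /iter_signed; case: leqP => hdi.
  apply: (exp_type_le _ (hle (i - d)%N _)) (@exp_type_orbit _ _); rewrite ?rnorm_ge0 ?mulr_ge0//.
  by move: hi hdi; case: i {hpi } => i /= _; lia.
apply: (exp_type_le _ (hle (d - i)%N _)) (@exp_type_orbitV _ _); rewrite ?rnorm_ge0 ?mulr_ge0//.
by move: hi hdi; case: i {hpi } => i /= _; lia.
Qed.

(** [s] is kept apart from [e D] because [bernstein] asks for a positive type, while [e] or [D] may
    vanish. *)
Lemma operator_bernstein m d (p : {poly C}) D M s x :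
  (forall i : nat, p`_i != 0 -> (`|i%:Z - d%:Z| <= D)%N) ->
  (forall z, circle z -> rnorm (laurent d p z) <= M) ->
  0 < s -> e * D%:R <= s ->
  rnorm (\sum_(k < m.+1) ((-1) ^+ k * 'C(m, k)%:R : C) *:
    laurent_op d p (orbit_op (2 * k%:R)) (orbit_opV (2 * k%:R)) x) <=
  (20 * s) ^+ m * M * rnorm x.
Proof.
move=> hD hM s0 es.
pose F t := laurent_op d p (orbit_op t) (orbit_opV t) x.
pose c := \sum_(i < size p) rnorm p`_i * rnorm x.
have c0 : 0 <= c by apply: sumr_ge0 => i _; rewrite mulr_ge0 ?rnorm_ge0.
have hF : exp_type s c F.
  by apply: exp_type_le es c0 (exp_type_laurent x hD); rewrite mulr_ge0.
have hFM t : rnorm (F t) <= M * rnorm x.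
  exact: (laurent_op_bound x (@orbit_adj t) (@orbitK t) (@orbitVK t) hM).
(* Centring at [t = m] puts the nodes at [2k]. *)
have := bernstein_iter m s0 c0 hF hFM m%:R; rewrite iter_cdiff1 mulrA.
rewrite (_ : rnorm (\sum_(k < m.+1) ((-1) ^+ k * 'C(m, k)%:R : C) *:
    laurent_op d p (orbit_op (2 * k%:R)) (orbit_opV (2 * k%:R)) x) =
  rnorm ((-1) ^+ m *: \sum_(k < m.+1) ((-1) ^+ k * 'C(m, k)%:R : C) *:
    laurent_op d p (orbit_op (2 * k%:R)) (orbit_opV (2 * k%:R)) x)); last first.
  by rewrite rnormZ rnormX rnormN rnorm1 expr1n mul1r.
congr (rnorm _ <= _); rewrite scaler_sumr; apply: eq_bigr => k _.
have km : (k <= m)%N by rewrite -ltnS.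
have sg j : (j <= m)%N -> (-1) ^+ (m - j) = (-1) ^+ m * (-1) ^+ j :> C.
  by move=> jm; rewrite -{2}(subnK jm) exprD -mulrA -expr2 sqrr_sign mulr1.
rewrite sg// scalerA mulrA (_ : m%:R + 2 * k%:R - m%:R = 2 * k%:R)//.
by ring.
Qed.

End OperatorBernstein.

(** * The continuous functional calculus *)

Section TrigForms.
Variable R : realType.
Local Notation C := (Cplx R).

Lemma laurent_shift d k (p : {poly C}) z : z != 0 ->
  laurent (d + k) (p * 'X^k) z = laurent d p z.
Proof.
move=> z0; rewrite /laurent hornerM hornerXn exprD invfM.
by rewrite [p.[z] * _]mulrC mulrA mulfVK ?expf_neq0.
Qed.

Lemma laurentB d (p q : {poly C}) z : laurent d (p - q) z = laurent d p z - laurent d q z.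
Proof. by rewrite /laurent hornerD hornerN mulrBr. Qed.

(* The coefficient of frequency [i - d] of a Laurent polynomial goes to [a] or
   [b] according to the sign of the frequency. *)
Definition trig_a d (p : {poly C}) n := p`_(d + n).
Definition trig_b d (p : {poly C}) n := if (0 < n <= d)%N then p`_(d - n) else 0.

(** Frequency 0 is assigned to [trig_a] alone, which is why [trig_b] vanishes at [n = 0]. *)
Lemma trig_split (X : lmodType C) d (p : {poly C}) (F G : nat -> X) N : (d < N)%N ->
  \sum_(n < N) (trig_a d p n *: F n + trig_b d p n *: G n) =
  \sum_(i < d + N) p`_i *: (if (d <= i)%N then F (i - d)%N else G (d - i)%N).
Proof.
move=> dN; rewrite big_split_ord big_split /= addrC; congr (_ + _); last first.
  by apply: eq_bigr => i _; rewrite leq_addr addKn.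
have -> : \sum_(n < N) trig_b d p n *: G n = \sum_(n < d.+1) trig_b d p n *: G n.
  rewrite [RHS](big_ord_widen _ (fun n => trig_b d p n *: G n) dN) [RHS]big_mkcond.
  apply: eq_bigr => i _; rewrite ltnS /trig_b; case: (leqP i d) => //= _.
  by rewrite andbF scale0r.
rewrite big_ord_recl /trig_b ltnn /= scale0r add0r.
rewrite (reindex_inj rev_ord_inj) /=; apply: eq_bigr => i _.
have hi := ltn_ord i.
have e : bump 0 (d - i.+1) = (d - i)%N by rewrite /bump; lia.
by rewrite e leq_subr subKn ?(ltnW hi)// leqNgt hi.
Qed.

Lemma trig_poly_laurent d (p : {poly C}) N z : circle z -> (d < N)%N ->
  (size p <= d + N)%N ->
  trig_poly (trig_a d p) (trig_b d p) N z = laurent d p z.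
Proof.
move=> hz dN sp; rewrite (laurentE _ sp) ?circle_neq0//.
rewrite /trig_poly (trig_split p (fun n => z ^+ n : C^o) (fun n => (z^*%R) ^+ n) dN).
apply: eq_bigr => i _; congr (_ * _); case: leqP => h.
  by rewrite exprnP subzn.
rewrite (circle_conj hz) exprVn exprnN; congr (_ ^ _).
by rewrite -subzn ?(ltnW h)// opprB.
Qed.

Definition laurent_of (a b : nat -> C) N : {poly C} :=
  \sum_(n < N) (a n *: 'X^(N + n) + b n *: 'X^(N - n)).

Lemma laurent_ofE a b N z : circle z ->
  laurent N (laurent_of a b N) z = trig_poly a b N z.
Proof.
move=> hz; have z0 := circle_neq0 hz.
rewrite /laurent /laurent_of horner_sum mulr_sumr; apply: eq_bigr => n _.
rewrite !hornerE mulrDr (circle_conj hz) exprD; congr (_ + _).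
  by rewrite mulrCA mulKf ?expf_neq0.
rewrite mulrCA; congr (_ * _).
have hn : (n <= N)%N := ltnW (ltn_ord n).
by rewrite exprVn -{1}(subnKC hn) exprD invfM mulfVK ?expf_neq0.
Qed.

End TrigForms.

Section Fcalc.
Variable R : realType.
Local Notation C := (Cplx R).
Variables (H : completeNormedModType C) (dot : {dot H for Num.conj}).
Hypothesis hdot : forall x : H, `|x| ^+ 2 = dot x x.
Variables V V' : {linear H -> H}.
Hypotheses (VV' : is_adjoint dot V V') (VK : cancel V V') (V'K : cancel V' V).

Lemma adjointE : adjoint dot V = V'.
Proof.
apply/funext => x; have : is_adjoint dot V (adjoint dot V).
  by rewrite /adjoint; case: xgetP => [S _ //|/(_ V')].
by move=> h; apply: (dot_inj (dot := dot)) => z; rewrite -h VV'.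
Qed.

Lemma pevX n (x : H) : pev 'X^n V x = iter n V x.
Proof.
elim: n x => [|n IH] x; first by rewrite expr0 -[1]/(1%:P) pevC scale1r.
by rewrite exprSr pevMX IH -iterSr.
Qed.

Lemma laurent_op_shift d k (p : {poly C}) (x : H) :
  laurent_op (d + k) (p * 'X^k) V V' x = laurent_op d p V V' x.
Proof.
rewrite /laurent_op mulrC pevM pevX iterD; congr (iter d _ _).
by elim: k => //= k IH; rewrite -[LHS]iterS iterSr VK.
Qed.

Lemma laurent_op_linear d (p : {poly C}) : linear (laurent_op d p V V').
Proof. by move=> a x y; rewrite /laurent_op pevDx pevZx iter_linear. Qed.

Lemma laurent_opB d (p q : {poly C}) x :
  laurent_op d (p - q) V V' x = laurent_op d p V V' x - laurent_op d q V V' x.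
Proof.
rewrite /laurent_op pevB -scaleN1r addrC iter_linear scaleN1r.
by rewrite addrC.
Qed.

(** Both forms are brought to the common shift [d + d']; von Neumann's inequality for the difference
    then makes evaluation at [V] Lipschitz for the uniform norm on the circle. *)
Lemma laurent_op_dist d p d' p' e x :
  (forall z, circle z -> rnorm (laurent d p z - laurent d' p' z) <= e) ->
  rnorm (laurent_op d p V V' x - laurent_op d' p' V V' x) <= e * rnorm x.
Proof.
move=> h; rewrite -(laurent_op_shift d d' p) -(laurent_op_shift d' d p') [(d' + d)%N]addnC.
rewrite -laurent_opB; apply: (laurent_op_bound hdot) => // z hz.
by rewrite laurentB laurent_shift ?circle_neq0// addnC laurent_shift ?circle_neq0// h.
Qed.

Lemma trig_op_laurent d (p : {poly C}) N x : (d < N)%N -> (size p <= d + N)%N ->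
  trig_op dot (trig_a d p) (trig_b d p) N V x = laurent_op d p V V' x.
Proof.
move=> dN sp; rewrite (laurent_opE d x VK sp) /trig_op adjointE.
by rewrite (trig_split p (fun n => iter n V x) (fun n => iter n V' x) dN).
Qed.

Lemma laurent_of_op a b N x :
  laurent_op N (laurent_of a b N) V V' x = trig_op dot a b N V x.
Proof.
rewrite /laurent_op /trig_op /laurent_of adjointE.
have -> : pev (\sum_(n < N) (a n *: 'X^(N + n) + b n *: 'X^(N - n))) V x =
   \sum_(n < N) (a n *: iter (N + n) V x + b n *: iter (N - n) V x).
  rewrite (big_morph (fun q => pev q V x) (fun q r => pevD q r V x) (pev0 V x)).
  by apply: eq_bigr => n _; rewrite pevD !pevZ !pevX.
have hs : forall (F : 'I_N -> H) k, iter k V' (\sum_(n < N) F n) = \sum_(n < N) iter k V' (F n).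
  by move=> F; elim=> //= k ->; rewrite linear_sum.
rewrite hs; apply: eq_bigr => n _; rewrite iter_linear.
have -> : iter N V' (b n *: iter (N - n) V x) = b n *: iter N V' (iter (N - n) V x).
  by elim: (N in iter N) => //= k ->; rewrite linearZ.
rewrite !(iter_cancel _ _ _ VK) /iter_signed leq_addr addKn.
have nN := ltn_ord n; case: (leqP N (N - n)) => hn; last by rewrite subKn ?(ltnW nN).
have n0 : nat_of_ord n = 0%N by lia.
by rewrite n0 subn0 subnn.
Qed.

Lemma opnorm_le (T : H -> H) e : (forall x, rnorm (T x) <= e * rnorm x) -> 0 <= e ->
  (opnorm T <= e%:E)%E.
Proof.
move=> hT e0; apply: ge_ereal_sup => _ [x /= hx <-]; rewrite lee_fin.
apply: le_trans (hT x) _; rewrite -[X in _ <= X]mulr1 ler_wpM2l//.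
by move: hx; rewrite rnormE -[1]/(1%:C%C) lecR.
Qed.

Lemma opnorm_bound (T : H -> H) e x : (forall a x, T (a *: x) = a *: T x) ->
  (opnorm T <= e%:E)%E -> rnorm (T x) <= e * rnorm x.
Proof.
move=> hT hle.
have h y : rnorm y <= 1 -> rnorm (T y) <= e.
  move=> hy; rewrite -lee_fin; apply: le_trans hle; apply: ereal_sup_ubound.
  by exists y => //=; rewrite rnormE -[1]/(1%:C%C) lecR.
have [->|x0] := eqVneq x 0.
  by rewrite -(scale0r (0 : H)) hT !scale0r !rnorm0 mulr0.
have nx : 0 < rnorm x by rewrite lt_neqAle rnorm_ge0 eq_sym rnorm_eq0 x0.
have rC : rnorm ((rnorm x)^-1%:C%C : C) = (rnorm x)^-1.
  by rewrite /rnorm ger0_norm// lecR invr_ge0 rnorm_ge0.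
have := h ((rnorm x)^-1%:C%C *: x); rewrite hT !rnormZ rC mulVf ?gt_eqF// lexx.
by move=> /(_ isT); rewrite ler_pdivrMl// mulrC.
Qed.

Variable f : C -> C.
Hypothesis f_dense : forall e : R, 0 < e -> exists d (p : {poly C}),
  (size p <= (2 * d).+1)%N /\ forall z, circle z -> rnorm (f z - laurent d p z) <= e.

(** [fcalc] picks its value by [xget] with default 0, so a witness has to be produced. The operators
    [u n] are pointwise Cauchy by [laurent_op_dist]; [Bd] bounds the distance from their limit to
    [p(V)] for every Laurent polynomial [p], which gives both linearity and the approximation in
    norm. *)
Lemma fcalc_exists : exists B, is_fcalc dot f V B.
Proof.
have eps n : 0 < n.+1%:R^-1 :> R by rewrite invr_gt0 ltr0n.
have hdp n : exists dp : nat * {poly C}, forall z, circle z ->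
    rnorm (f z - laurent dp.1 dp.2 z) <= n.+1%:R^-1.
  by have [d [p [_ hp]]] := f_dense (eps n); exists (d, p).
have {hdp}[s hs] := choice hdp.
pose u n x := laurent_op (s n).1 (s n).2 V V' x.
have uh n d p e x : (forall z, circle z -> rnorm (f z - laurent d p z) <= e) ->
    rnorm (u n x - laurent_op d p V V' x) <= (n.+1%:R^-1 + e) * rnorm x.
  move=> he; apply: laurent_op_dist => z hz.
  rewrite (_ : laurent _ _ z - _ = (f z - laurent d p z) - (f z - laurent (s n).1 (s n).2 z)).
    by rewrite [X in _ <= X]addrC; apply: le_trans (ler_rnormB _ _) (lerD (he z hz) (hs n z hz)).
  by rewrite opprB [RHS]addrC addrA subrK.
have arch (e : R) : 0 < e -> exists N, forall n, (N <= n)%N -> n.+1%:R^-1 <= e.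
  move=> e0; exists (Num.Def.archi_bound e^-1) => n hn.
  rewrite -[e]invrK lef_pV2 ?posrE ?invr_gt0 ?ltr0n//.
  apply: le_trans (ltW (archi_boundP _)) _; first by rewrite invr_ge0 ltW.
  by rewrite ler_nat leqW.
pose B x := limn (fun n => u n x).
have Blim x e : 0 < e -> exists N, forall n, (N <= n)%N -> rnorm (u n x - B x) <= e.
  move=> e0; apply: (@rnorm_cauchy_lim R H (fun n => u n x)) => // {}e {}e0.
  have x1 : 0 < 2 * (rnorm x + 1) by rewrite mulr_gt0// ltr_wpDl// rnorm_ge0.
  have [N hN] := arch _ (divr_gt0 e0 x1).
  exists N => n hn; apply: le_trans (uh n _ _ _ x (hs N)) _.
  have h1 := hN n hn; have h2 := hN N (leqnn N).
  apply: le_trans (_ : (e / (2 * (rnorm x + 1)) + e / (2 * (rnorm x + 1))) * (rnorm x + 1) <= _).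
    have h0 : 0 <= n.+1%:R^-1 + N.+1%:R^-1 :> R by rewrite addr_ge0 ?(ltW (eps _)).
    by apply: (ler_pM h0 (rnorm_ge0 x) (lerD h1 h2)); rewrite lerDl.
  rewrite le_eqVlt; apply/orP; left; apply/eqP.
  by field; rewrite gt_eqF// ltr_wpDl// rnorm_ge0.
have Bd d p e x : (forall z, circle z -> rnorm (f z - laurent d p z) <= e) ->
    rnorm (B x - laurent_op d p V V' x) <= e * rnorm x.
  move=> he; apply/ler_addgt0Pl => r r0.
  have x1 : 0 < 2 * (rnorm x + 1) by rewrite mulr_gt0// ltr_wpDl// rnorm_ge0.
  have [N1 h1] := Blim x _ (divr_gt0 r0 (ltr0n R 2)).
  have [N2 h2] := arch _ (divr_gt0 r0 x1).
  pose n := maxn N1 N2.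
  have {}h1 := h1 n (leq_maxl _ _); have {}h2 := h2 n (leq_maxr _ _).
  rewrite (_ : B x - _ = (B x - u n x) + (u n x - laurent_op d p V V' x)); last first.
    by rewrite addrA subrK.
  apply: le_trans (ler_rnormD _ _) _; rewrite rdistC.
  have h3 := uh n d p e x he.
  have h4 : n.+1%:R^-1 * rnorm x <= r / 2.
    apply: le_trans (ler_wpM2r (rnorm_ge0 x) h2) _.
    rewrite mulrAC ler_pdivrMr//; have := rnorm_ge0 x; nra.
  by move: h1 h3 h4; rewrite mulrDl; move: (n.+1%:R^-1 * _) (e * _) => q1 q2; lra.
exists B; split.
  move=> a x y; apply/eqP; rewrite -subr_eq0; apply/eqP.
  apply: (@rnorm_small0 _ _ _ (rnorm (a *: x + y) + rnorm a * rnorm x + rnorm y)) => e e0.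
  have [d [p [_ hp]]] := f_dense e0.
  have k1 := Bd d p e (a *: x + y) hp; have k2 := Bd d p e x hp; have k3 := Bd d p e y hp.
  move: k1 k2 k3; rewrite laurent_op_linear.
  move: (laurent_op d p V V' x) (laurent_op d p V V' y) (B (a *: x + y)) (B x) (B y).
  move=> P Q z1 z2 z3 k1 k2 k3.
  have -> : z1 - (a *: z2 + z3) = (z1 - (a *: P + Q)) + - (a *: (z2 - P)) + - (z3 - Q).
    rewrite scalerBr !opprB -[RHS]addrA [X in _ = _ + X]addrACA.
    by rewrite [RHS]addrA subrK opprD.
  apply: le_trans (ler_rnormD _ _) _; rewrite !mulrDl; apply: lerD; last by rewrite rnormN mulrC.
  apply: le_trans (ler_rnormD _ _) _; apply: lerD; first by rewrite mulrC.
  by rewrite rnormN rnormZ -mulrA ler_wpM2l ?rnorm_ge0// mulrC.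
move=> e e0; have [d [p [sp hp]]] := f_dense e0.
have sN : (size p <= d + d.+1)%N by move: sp; lia.
exists (trig_a d p), (trig_b d p), d.+1; split=> [z hz|].
  by rewrite trig_poly_laurent ?hp.
apply: opnorm_le (ltW e0) => x; rewrite trig_op_laurent//.
exact: Bd.
Qed.

(** A trigonometric polynomial supplied by [is_fcalc] is close to [f] on the circle and to [B] at
    [V]; [laurent_op_dist] compares it with [p]. *)
Lemma fcalc_dist d (p : {poly C}) e x :
  (forall z, circle z -> rnorm (f z - laurent d p z) <= e) ->
  rnorm (fcalc dot f V x - laurent_op d p V V' x) <= e * rnorm x.
Proof.
move=> he; have : is_fcalc dot f V (fcalc dot f V).
  by rewrite /fcalc; case: xgetP => [B _ //|]; have [B hB] := fcalc_exists => /(_ B).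
set B := fcalc dot f V => -[linB hB].
apply/ler_addgt0Pl => r r0.
have x1 : 0 < 2 * (rnorm x + 1) by rewrite mulr_gt0// ltr_wpDl// rnorm_ge0.
have [a [b [N [hab hop]]]] := hB _ (divr_gt0 r0 x1).
set e' := r / _ in hab hop.
have h1 : rnorm (B x - trig_op dot a b N V x) <= e' * rnorm x.
  apply: (@opnorm_bound (fun x => B x - trig_op dot a b N V x)) => // k y.
  pose Bl : {linear H -> H} := HB.pack B (GRing.isLinear.Build _ _ _ _ _ linB).
  rewrite -[B]/(Bl : H -> H) linearZ /= -!laurent_of_op scalerBr; congr (_ - _).
  by rewrite /laurent_op pevZx; elim: (N in iter N) => //= n ->; rewrite linearZ.
have h2 : rnorm (trig_op dot a b N V x - laurent_op d p V V' x) <= (e' + e) * rnorm x.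
  rewrite -laurent_of_op; apply: laurent_op_dist => z hz; rewrite laurent_ofE//.
  rewrite (_ : _ - _ = (f z - laurent d p z) - (f z - trig_poly a b N z)).
    by rewrite [X in _ <= X]addrC; apply: le_trans (ler_rnormB _ _) (lerD (he z hz) (hab z hz)).
  by rewrite opprB [RHS]addrC addrA subrK.
rewrite -[B x](subrK (trig_op dot a b N V x)) -addrA.
apply: le_trans (ler_rnormD _ _) _; apply: le_trans (lerD h1 h2) _.
have : 2 * e' * rnorm x <= r.
  rewrite /e' mulrAC mulrA ler_pdivrMr//; have := rnorm_ge0 x; nra.
lra.
Qed.

End Fcalc.

(** * Compactness of the circle *)

Section CircleCompact.
Variable R : realType.
Local Notation C := (Cplx R).

Let arc (s : R) (x : R) : C := (x +i* (s * Num.sqrt (1 - x ^+ 2)))%C.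

Lemma cvg_rnorm (T : Type) (F : set_system T) (FF : Filter F) (V : normedModType C)
    (f : T -> V) (y : V) :
  f @ F --> y <-> forall e : R, 0 < e -> \forall x \near F, rnorm (f x - y) < e.
Proof.
split=> [/cvgrPdist_lt h e e0|h].
  have := h e%:C%C; rewrite ltcR => /(_ e0); apply: filterS => x.
  by rewrite distrC rnormE ltcR.
apply/cvgrPdist_lt => e e0.
have ee : e = (complex.Re e)%:C%C by rewrite [LHS]complexE (ger0_Im (ltW e0)) mulr0 addr0.
have r0 : 0 < complex.Re e by move: e0; rewrite ee ltcR.
apply: filterS (h _ r0) => x; rewrite distrC rnormE => hx.
by rewrite ee ltcR.
Qed.

Lemma rnorm_complex_le (x y : R) : rnorm ((x +i* y)%C : C) <= `|x| + `|y|.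
Proof.
have -> : ((x +i* y)%C : C) = x%:C%C + 'i%C * y%:C%C by rewrite [LHS]complexE.
apply: le_trans (ler_rnormD _ _) _; rewrite rnormM.
have h (u : R) : rnorm (u%:C%C : C) = `|u|.
  by rewrite /rnorm normc_def /= expr0n addr0 sqrtr_sqr.
rewrite !h; have -> : rnorm ('i%C : C) = 1.
  by rewrite /rnorm normc_def /= expr0n add0r expr1n sqrtr1.
by rewrite mul1r.
Qed.

Lemma arc_continuous s : continuous (arc s).
Proof.
move=> x; apply/cvg_rnorm => e e0.
have e2 : 0 < e / 2 by rewrite divr_gt0.
have h2 : (fun y => s * Num.sqrt (1 - y ^+ 2)) @ x --> s * Num.sqrt (1 - x ^+ 2).
  apply: cvgM; first exact: cvg_cst.
  apply: continuous_comp; last exact: sqrt_continuous.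
  apply: cvgB; first exact: cvg_cst.
  exact: exprn_continuous.
have /cvgrPdist_lt /(_ _ e2) h1 : (y @[y --> x]) --> x by [].
move/cvgrPdist_lt : h2 => /(_ _ e2) h2.
near=> y.
have -> : arc s y - arc s x =
   ((y - x) +i* (s * Num.sqrt (1 - y ^+ 2) - s * Num.sqrt (1 - x ^+ 2)))%C by [].
apply: le_lt_trans (rnorm_complex_le _ _) _.
rewrite [e]splitr; apply: ltrD; rewrite distrC; near: y; [exact: h1|exact: h2].
Unshelve. all: by end_near.
Qed.

(** The two closed half circles are the images of [[-1, 1]] under [arc 1] and [arc (-1)]. *)
Lemma circle_compact : compact (@circle R).
Proof.
have -> : @circle R = (arc 1 @` `[-1, 1]) `|` (arc (-1) @` `[-1, 1]).
  apply/seteqP; split=> [[x y]|z].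
    rewrite /circle /= normc_def /= => -[] /(congr1 (fun u => u ^+ 2)).
    rewrite expr1n sqr_sqrtr ?addr_ge0 ?sqr_ge0// => xy.
    have hx : x \in `[-1, 1].
      by rewrite in_itv /= -ler_norml -(@expr_le1 _ 2)// real_normK ?num_real//; nra.
    have yE : Num.sqrt (1 - x ^+ 2) = `|y| by rewrite -sqrtr_sqr; congr Num.sqrt; lra.
    case: (leP 0 y) => y0; [left|right]; exists x => //; rewrite /arc yE.
      by rewrite mul1r ger0_norm.
    by rewrite ltr0_norm// mulN1r opprK.
  have h s : s ^+ 2 = 1 -> forall x, x \in `[-1, 1] -> circle (arc s x).
    move=> s1 x; rewrite in_itv /= => /andP[x1 x2].
    rewrite /circle /= normc_def /= exprMn s1 mul1r sqr_sqrtr; last by nra.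
    by rewrite addrC subrK sqrtr1.
  by case=> -[x hx <-]; apply: h hx; rewrite ?sqrrN expr1n.
apply: compactU; apply: continuous_compact; try exact: segment_compact;
  exact/continuous_subspaceT/arc_continuous.
Qed.

Variable f : C -> C.
Hypothesis fcont : {within @circle R, continuous f}.

Lemma circle_cvg z : circle z -> forall e : R, 0 < e ->
  exists2 r : R, 0 < r & forall y, circle y -> rnorm (y - z) < r -> rnorm (f y - f z) < e.
Proof.
move=> hz e e0.
have /cvg_rnorm /(_ e e0) := (subspace_continuousP _ _).1 fcont z hz.
move=> /nbhs_ballP [r /= r0 hr].
have re : r = (complex.Re r)%:C%C by rewrite [LHS]complexE (ger0_Im (ltW r0)) mulr0 addr0.
exists (complex.Re r); first by move: r0; rewrite re ltcR.
move=> y hy yz; apply: hr hy.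
by rewrite -ball_normE /= distrC rnormE re ltcR.
Qed.

(** Compactness in near-covering form: what holds locally for all large [n] holds on the whole
    circle for a single [n]. Boundedness and uniform continuity are two choices of [P]. *)
Lemma circle_covering (P : nat -> C -> Prop) :
  (forall z, circle z -> exists (r : R) (N : nat), 0 < r /\
     forall y n, rnorm (y - z) < r -> (N <= n)%N -> P n y) ->
  exists n, forall z, circle z -> P n z.
Proof.
move=> h; have := (compact_near_coveringP _).1 circle_compact.
move=> /(_ nat \oo P _) [z hz|N _ hN].
  have [r [N [r0 hr]]] := h z hz.
  exists (ball z r%:C%C, [set n | (N <= n)%N]); first split => /=.
  - by apply/nbhs_ballP; exists r%:C%C => //=; rewrite ltcR.
  - by exists N.
  move=> [y n] [/=]; rewrite -ball_normE /= distrC rnormE ltcR; exact: hr.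
by exists N => z hz; exact: (hN N (leqnn N)).
Qed.

Lemma circle_bounded : exists M, forall z, circle z -> rnorm (f z) <= M.
Proof.
suff /(@circle_covering (fun n z => circle z -> rnorm (f z) <= n%:R)) [n hn] :
    forall z, circle z -> exists (r : R) (N : nat), 0 < r /\ forall y n,
      rnorm (y - z) < r -> (N <= n)%N -> circle y -> rnorm (f y) <= n%:R.
  by exists n%:R => z hz; exact: hn.
move=> z hz; have [r r0 hr] := circle_cvg hz ltr01.
exists r, (Num.Def.archi_bound (rnorm (f z) + 1)); split => // y n yz nN hy.
rewrite -[f y](subrK (f z)); apply: le_trans (ler_rnormD _ _) _.
have h1 := hr y hy yz.
have h2 : rnorm (f z) + 1 < (Num.Def.archi_bound (rnorm (f z) + 1))%:R.
  by apply: archi_boundP; rewrite addr_ge0 ?rnorm_ge0.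
have h3 : (Num.Def.archi_bound (rnorm (f z) + 1))%:R <= n%:R :> R by rewrite ler_nat.
lra.
Qed.

Lemma circle_unif (e : R) : 0 < e -> exists2 r : R, 0 < r &
  forall z y, circle z -> circle y -> rnorm (z - y) < r -> rnorm (f z - f y) <= e.
Proof.
move=> e0.
pose P n z := forall y, circle z -> circle y ->
  rnorm (z - y) < n.+1%:R^-1 -> rnorm (f z - f y) <= e.
suff /(@circle_covering P) [n hn] : forall z, circle z -> exists (r : R) (N : nat),
    0 < r /\ forall y n, rnorm (y - z) < r -> (N <= n)%N -> P n y.
  by exists n.+1%:R^-1 => [|z y hz hy]; [rewrite invr_gt0 ltr0n|exact: hn].
move=> z hz; have e2 : 0 < e / 2 by rewrite divr_gt0.
have [r r0 hr] := circle_cvg hz e2.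
exists (r / 2), (Num.Def.archi_bound (2 / r)); split; first by rewrite divr_gt0.
move=> y n yz nN u hy hu yu.
have h3 : n.+1%:R^-1 <= r / 2.
  have h4 : 2 / r < n.+1%:R.
    apply: lt_le_trans (archi_boundP _) _; first by rewrite divr_ge0 ?ltW.
    by rewrite ler_nat leqW.
  by rewrite -[r / 2]invrK lef_pV2 ?posrE ?invr_gt0 ?divr_gt0 ?ltr0n// invf_div ltW.
have yz' : rnorm (y - z) < r by lra.
have uz : rnorm (u - z) < r.
  rewrite (_ : u - z = (u - y) + (y - z)); last by rewrite addrA subrK.
  apply: le_lt_trans (ler_rnormD _ _) _; rewrite (rdistC u) (splitr r).
  exact: ltrD (lt_le_trans yu h3) yz.
have := hr _ hy yz'; have := hr _ hu uz.
rewrite (_ : f y - f u = (f y - f z) + (f z - f u)); last by rewrite addrA subrK.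
rewrite (rdistC (f u)) => k1 k2.
by apply: le_trans (ler_rnormD _ _) _; lra.
Qed.

End CircleCompact.

(** * Lower sums for omega_star *)

Section OmegaStar.
Variables (R : realType) (m : nat) (w : R -> R).
Hypothesis w_gt0 : forall x, 0 < x -> 0 < w x.
Hypothesis w_mono : forall x y, 0 < x -> x <= y -> w x <= w y.

Let g t : \bar R := (w t / t ^+ m.+1)%:E.

(** [w] is monotone on the positive reals only; replacing [t] by [max t x] changes nothing on [D]
    and makes both factors monotone on the whole line. *)
Lemma omega_integrand_measurable x (D : set R) : 0 < x -> measurable D ->
  D `<=` `[x, +oo[ -> measurable_fun D (fun t => w t / t ^+ m.+1).
Proof.
move=> x0 mD hD.
pose h t := w (Num.max t x) * ((Num.max t x) ^+ m.+1)^-1.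
have mx t : 0 < Num.max t x by rewrite lt_max x0 orbT.
have maxle s t : s <= t -> Num.max s x <= Num.max t x.
  by move=> st; rewrite ge_max !le_max st lexx orbT.
apply: (@eq_measurable_fun _ _ _ _ D h).
  move=> t; rewrite inE => /hD /=; rewrite in_itv /= andbT => xt.
  by rewrite /h (max_idPl xt).
apply: measurable_funM.
  by apply: nondecreasing_measurable => // s t /maxle; exact: w_mono.
apply: nonincreasing_measurable => // s t /maxle st.
by rewrite lef_pV2 ?posrE ?exprn_gt0 ?mx// lerXn2r ?nnegrE ?(ltW (mx _)).
Qed.

(** On [[2^i x, 2^(i+1) x[] the integrand is at least its numerator at the left end over its
    denominator at the right end. Working with finite sums allows for an infinite integral. *)
Lemma omega_integral_ge n x : 0 < x ->
  ((\sum_(i < n) w (2 ^+ i * x) / (2 ^+ i.+1 * x) ^+ m.+1 * (2 ^+ i * x))%:E <=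
   \int[lebesgue_measure]_(t in `[x, +oo[) g t)%E.
Proof.
have g0 x' t : 0 < x' -> x' <= t -> (0 <= g t)%E.
  move=> h1 h2; have t0 := lt_le_trans h1 h2.
  by rewrite lee_fin divr_ge0 ?exprn_ge0 ?ltW ?w_gt0.
elim: n x => [|n IH] x x0.
  rewrite big_ord0; apply: integral_ge0 => t /=; rewrite in_itv /= andbT; exact: (g0 x t x0).
have x2 : 0 < 2 * x by rewrite mulr_gt0.
have xx2 : x <= 2 * x by lra.
have -> : `[x, +oo[%classic = `[x, 2 * x[%classic `|` `[2 * x, +oo[%classic.
  apply/seteqP; split => t /=; rewrite !in_itv /= !andbT.
    by move=> xt; case: (ltP t (2 * x)) => h; [left; rewrite xt|right].
  by case=> [/andP[]//|]; apply: le_trans.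
rewrite ge0_integral_setU//; first last.
- apply/disj_setPS => t /=; rewrite !in_itv /= andbT => -[/andP[_ h1] h2].
  by have := lt_le_trans h1 h2; rewrite ltxx.
- move=> t [] /=; rewrite in_itv /= ?andbT; first by move=> /andP[h _]; exact: (g0 _ _ x0 h).
  by move=> h; exact: (g0 _ _ x2 h).
- apply/measurable_EFinP; apply: (omega_integrand_measurable x0); first exact: measurableU.
  move=> t [] /=; rewrite !in_itv /= ?andbT; first by case/andP.
  exact: le_trans.
rewrite big_ord_recl EFinD; apply: leeD; last first.
  apply: le_trans (IH _ x2); rewrite lee_fin le_eqVlt; apply/orP; left; apply/eqP.
  apply: eq_bigr => i _; rewrite lift0.
  have e k : 2 ^+ k.+1 * x = 2 ^+ k * (2 * x) by rewrite exprSr mulrA.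
  by rewrite !e.
apply: (@le_trans _ _ (\int[@lebesgue_measure R]_(t in `[x, (2 * x)%R[%classic) cst (w x / (2 * x) ^+ m.+1)%:E t)%E).
  rewrite integral_cst//= lebesgue_measure_itv /= lte_fin.
  rewrite ifT; last by lra.
  by rewrite -EFinB -EFinM lee_fin expr0 !mul1r expr1 (_ : 2 * x - x = x)//; ring.
apply: ge0_le_integral => //.
- by move=> t _; rewrite lee_fin divr_ge0 ?exprn_ge0 ?ltW ?w_gt0.
- apply/measurable_EFinP; apply: (omega_integrand_measurable x0) => // t /=; rewrite !in_itv /= andbT.
  by case/andP.
move=> t /=; rewrite in_itv /= => /andP[h1 h2].
have t0 := lt_le_trans x0 h1.
rewrite lee_fin ler_pM ?invr_ge0 ?exprn_ge0 ?w_mono// ?ltW ?w_gt0//.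
by rewrite ltf_pV2 ?posrE ?exprn_gt0// ltrXn2r ?nnegrE ?ltW.
Qed.

Lemma omega_star_ge n x : 0 < x ->
  ((2 ^- m.+1 * \sum_(i < n) w (2 ^+ i * x) / 2 ^+ (m * i))%:E <= omega_star w m x)%E.
Proof.
move=> x0; rewrite /omega_star gt_eqF//.
apply: le_trans (lee_wpmul2l _ (omega_integral_ge n x0)); last first.
  by rewrite lee_fin exprn_ge0 ?ltW.
rewrite -EFinM lee_fin !mulr_sumr; apply: ler_sum => i _.
have xn : x != 0 by rewrite gt_eqF.
have i0 : 2 ^+ i != 0 :> R by rewrite expf_neq0.
rewrite le_eqVlt; apply/orP; left; apply/eqP.
rewrite mulnC exprM [2 ^+ i.+1]exprS !exprMn.
move: (2 ^+ i) i0 (w _) => T T0 v.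
rewrite (exprS T) (exprS x) ; field.
by rewrite xn T0 !expf_neq0.
Qed.

End OmegaStar.

(** * The main estimate *)

Lemma sum_binomial_alt (F : comNzRingType) m : (0 < m)%N ->
  \sum_(k < m.+1) (-1) ^+ k * 'C(m, k)%:R = 0 :> F.
Proof.
move=> m0; have := exprDn (1 : F) (-1) m; rewrite subrr expr0n gtn_eqF// => e.
rewrite [RHS]e; apply: eq_bigr => k _.
by rewrite expr1n mul1r mulr_natr.
Qed.

Section Estimate.
Variables (R : realType) (m : nat).
Local Notation C := (Cplx R).
Hypothesis m_gt0 : (0 < m)%N.
Variables (w : R -> R) (f : C -> C) (lam : R).
Hypothesis w_gt0 : forall x, 0 < x -> 0 < w x.
Hypothesis w_mono : forall x y, 0 < x -> x <= y -> w x <= w y.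
Hypothesis w_dbl : forall x, 0 < x -> w (2 * x) <= 2 ^+ m * w x.
Hypothesis lam_ge0 : 0 <= lam.
Hypothesis f_lam : forall t z, circle t -> t != 1 -> circle z ->
  rnorm (iter m (Delta t) f z) <= lam * w (rnorm (1 - t)).
Hypothesis f_dense : forall e : R, 0 < e -> exists d (p : {poly C}),
  (size p <= (2 * d).+1)%N /\ forall z, circle z -> rnorm (f z - laurent d p z) <= e.

(** [2^m] comes from [doubling_bound]; the other factor is the mass of the kernel plus the bound on
    its moment. *)
Definition jackson_cst : R := 2 ^+ m * (1 + m.+1%:R * 4 ^+ m).

Lemma jackson_cst_ge0 : 0 <= jackson_cst.
Proof. by rewrite mulr_ge0 ?addr_ge0 ?mulr_ge0 ?exprn_ge0. Qed.

(** The Jackson step, with [N = 2^j], acts on [g], whose [m]-th differences deviate from those of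
    [f] by at most [2^m eta]. *)
Lemma jackson_Lambda d (g : {poly C}) eta j : 0 <= eta -> (size g <= (2 * d).+1)%N ->
  (forall z, circle z -> rnorm (f z - laurent d g z) <= eta) ->
  exists h : {poly C}, [/\ (size h <= (2 * d).+1)%N,
    (forall i : nat, h`_i != 0 -> (`|i%:Z - d%:Z| <= m.+1 * (2 ^ j).-1)%N) &
    forall z, circle z -> rnorm (laurent d g z - laurent d h z) <=
      jackson_cst * lam * w (2 ^- j) + 2 ^+ m * eta].
Proof.
move=> eta0 sg hg; have N0 : (0 < 2 ^ j)%N by rewrite expn_gt0.
have [h [sh hh] hJ] := jackson m N0 sg; exists h; split => // z hz.
have jE : (2 ^ j)%:R^-1 = 2 ^- j :> R by rewrite natrX.
have wj : 0 < w (2 ^- j) by apply: w_gt0; rewrite invr_gt0 exprn_gt0.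
have a0 : 0 <= lam * 2 ^+ m * w (2 ^- j) by rewrite !mulr_ge0 ?exprn_ge0// ltW.
have b0 : 0 <= 2 ^+ m * eta by rewrite mulr_ge0 ?exprn_ge0.
have := hJ _ (2 ^+ m * eta) a0 _ z hz.
rewrite /jackson_cst [X in _ -> _ <= X + _](_ : _ = lam * 2 ^+ m * w (2 ^- j) * (1 + m.+1%:R * 4 ^+ m)); last by ring.
apply=> t y ht hy.
(* [f_lam] says nothing at [t = 1]; there the difference vanishes since [m > 0]. *)
have [->|t1] := eqVneq t 1.
  have -> : iter m (Delta 1) (laurent d g) y = 0.
    by case: (m) m_gt0 => // k _; rewrite iterS /Delta mul1r subrr.
  rewrite rnorm0 addr_ge0//; apply: mulr_ge0 => //.
  by rewrite addr_ge0 ?exprn_ge0 ?mulr_ge0 ?rnorm_ge0.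
rewrite -[iter m _ _ y](subKr (iter m (Delta t) f y)) [X in rnorm X]addrC.
apply: le_trans (ler_rnormD _ _) _; rewrite addrC rnormN; apply: lerD; last first.
  exact: iter_Delta_dist.
apply: le_trans (f_lam ht t1 hy) _.
rewrite -!mulrA ler_wpM2l// mulrA -jE; apply: doubling_bound => //.
by rewrite lt_neqAle rnorm_ge0 eq_sym rnorm_eq0 subr_eq0 eq_sym t1.
Qed.

Variables (H : completeNormedModType C) (dot : {dot H for Num.conj}).
Hypothesis hdot : forall x : H, `|x| ^+ 2 = dot x x.
Variables (W : R -> {linear H -> H}) (U U' : {linear H -> H}).
Hypothesis WD : forall t u x, W (t + u) x = W t (W u x).
Hypothesis W0 : forall x, W 0 x = x.
Hypothesis W_adj : forall t, is_adjoint dot (W t) (W (- t)).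
Hypotheses (U_adj : is_adjoint dot U U') (UK : cancel U U') (U'K : cancel U' U).
Variable e : R.
Hypothesis e_ge0 : 0 <= e.
Hypothesis We : forall x, rnorm (W 1 x - x) <= e * rnorm x.

Let V k := orbit_op W U (2 * k%:R).
Let V' k := orbit_opV W U' (2 * k%:R).
Let sgnC k : C := (-1) ^+ k * 'C(m, k)%:R.

Let VK k : cancel (V k) (V' k).
Proof. exact: orbitK. Qed.

Let V'K k : cancel (V' k) (V k).
Proof. exact: orbitVK. Qed.

Let V_adj k : is_adjoint dot (V k) (V' k).
Proof. exact: orbit_adj. Qed.

Let diffop d p x := \sum_(k < m.+1) sgnC k *: laurent_op d p (V k) (V' k) x.

Lemma diff_sum_le (F : nat -> H) b : (forall k, rnorm (F k) <= b) ->
  rnorm (\sum_(k < m.+1) sgnC k *: F k) <= 2 ^+ m * b.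
Proof.
move=> hF; apply: le_trans (rnorm_sum _ _ _) _.
have -> : 2 ^+ m * b = \sum_(k < m.+1) 'C(m, k)%:R * b.
  rewrite -mulr_suml; congr (_ * _); rewrite (_ : 2 = 1 + 1)// exprDn.
  by apply: eq_bigr => k _; rewrite !expr1n mul1r.
apply: ler_sum => k _; rewrite rnormZ rnormM rnormX rnormN rnorm1 expr1n mul1r.
by rewrite rnorm_nat ler_wpM2l.
Qed.

Lemma diffopB d p q x : diffop d (p - q) x = diffop d p x - diffop d q x.
Proof.
by rewrite -sumrB; apply: eq_bigr => k _; rewrite laurent_opB scalerBr.
Qed.

(** Starts the telescoping: [h 0] has degree 0, and alternating binomial coefficients cancel on a
    constant. *)
Lemma diffop_const d (p : {poly C}) x :
  (forall i : nat, p`_i != 0 -> (`|i%:Z - d%:Z| <= 0)%N) -> diffop d p x = 0.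
Proof.
move=> hp.
have h k : laurent_op d p (V k) (V' k) x = \sum_(i < size p) p`_i *: x.
  rewrite (laurent_opE d x (@VK k) (leqnn _)); apply: eq_bigr => i _.
  have [->|/hp hi] := eqVneq p`_i 0; first by rewrite !scale0r.
  have -> : d = i :> nat by move: hi; case: i => i /= _; lia.
  by rewrite /iter_signed leqnn subnn.
rewrite /diffop; under eq_bigr do rewrite h.
by rewrite -scaler_suml sum_binomial_alt// scale0r.
Qed.

(** For [n = 0] the sum over [j] is empty and only the trivial bound is applied, so [e <= a] is
    asked for [n > 0] only. *)
Lemma main_estimate a n x : 0 < a -> (0 < n)%N ==> (e <= a) ->
  rnorm (\sum_(k < m.+1) sgnC k *: fcalc dot f (V k) x) <=
  jackson_cst * lam * (2 ^+ m * w (2 ^- n) +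
    \sum_(j < n) 2 * (20 * (a * (m.+1 * 2 ^ j.+1)%:R)) ^+ m * w (2 ^- j)) * rnorm x.
Proof.
(* The Bernstein factor for [h j.+1 - h j], of degree at most [(m+1) 2^(j+1)]; the leading 2 is
   there because this difference is bounded by [2 E j]. *)
move=> a0 hn; pose b j := 2 * (20 * (a * (m.+1 * 2 ^ j.+1)%:R)) ^+ m.
have bge j : 0 <= b j by rewrite mulr_ge0// exprn_ge0// !mulr_ge0// ltW.
have K0 := jackson_cst_ge0.
(* The total weight of [eta], from [f - g], from [g - h n] and from the telescoped differences;
   [eta = r / (Q + 1)] makes its contribution at most [r]. *)
pose Q : R := (2 ^+ m + 2 ^+ m * 2 ^+ m + (\sum_(j < n) b j) * 2 ^+ m) * rnorm x.
have Q0 : 0 <= Q by rewrite mulr_ge0 ?rnorm_ge0// !addr_ge0 ?mulr_ge0 ?exprn_ge0 ?sumr_ge0.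
apply/ler_addgt0Pl => r r0.
have Q1 : 0 < Q + 1 by lra.
pose eta := r / (Q + 1); have eta0 : 0 < eta by rewrite divr_gt0.
have [d [g [sg hg]]] := f_dense eta0.
have hex j := jackson_Lambda j (ltW eta0) sg hg.
have [h hh] := choice hex.
pose E j := jackson_cst * lam * w (2 ^- j) + 2 ^+ m * eta.
have Emono j : E j.+1 <= E j.
  rewrite lerD2r ler_wpM2l ?mulr_ge0// w_mono ?invr_gt0 ?exprn_gt0//.
  by rewrite lef_pV2 ?posrE ?exprn_gt0// exprS ler_peMl ?exprn_ge0// ler1n.
have E0 j : 0 <= E j.
  have wj : 0 < w (2 ^- j) by rewrite w_gt0 ?invr_gt0 ?exprn_gt0.
  apply: addr_ge0; apply: mulr_ge0; rewrite ?exprn_ge0 ?(ltW eta0) ?(ltW wj)//.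
  exact: mulr_ge0.
have s1 : rnorm (\sum_(k < m.+1) sgnC k *: fcalc dot f (V k) x - diffop d g x) <=
    2 ^+ m * (eta * rnorm x).
  rewrite -sumrB (eq_bigr (fun k : 'I_m.+1 => sgnC k *:
    (fcalc dot f (V k) x - laurent_op d g (V k) (V' k) x))) => [|k _]; last by rewrite scalerBr.
  apply: (@diff_sum_le (fun k => fcalc dot f (V k) x - laurent_op d g (V k) (V' k) x)) => k.
  exact: (fcalc_dist hdot (@V_adj k) (@VK k) (@V'K k) f_dense _ hg).
have s2 : rnorm (diffop d g x - diffop d (h n) x) <= 2 ^+ m * (E n * rnorm x).
  rewrite -diffopB.
  apply: (@diff_sum_le (fun k => laurent_op d (g - h n) (V k) (V' k) x)) => k.
  apply: (laurent_op_bound hdot) => // z hz; rewrite laurentB.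
  by have [_ _] := hh n; exact.
have s3 j : (j < n)%N -> rnorm (diffop d (h j.+1) x - diffop d (h j) x) <= b j * E j * rnorm x.
  move=> jn; have ea : e <= a by move: hn; rewrite (leq_ltn_trans _ jn).
  rewrite -diffopB; have [_ f1 k1] := hh j; have [_ f2 k2] := hh j.+1.
  pose s := a * (m.+1 * 2 ^ j.+1)%:R.
  have s0 : 0 < s by rewrite mulr_gt0// ltr0n muln_gt0 expn_gt0.
  have := @operator_bernstein R H dot hdot W U U' WD W0 W_adj U_adj UK U'K e e_ge0 We
    m d (h j.+1 - h j) (m.+1 * 2 ^ j.+1)%N (2 * E j) s x.
  rewrite -/(diffop d _ x) => /(_ _ _ s0 _)/le_trans; apply.
  - move=> i; rewrite coefB => hi.
    have [z1|z1] := eqVneq (h j.+1)`_i 0; last first.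
      by apply: leq_trans (f2 i z1) _; rewrite leq_mul2l leq_pred orbT.
    rewrite z1 sub0r oppr_eq0 in hi; apply: leq_trans (f1 i hi) _.
    rewrite leq_mul2l; apply/orP; right; apply: leq_trans (leq_pred _) _.
    by rewrite leq_exp2l.
  - move=> z hz; rewrite laurentB.
    rewrite (_ : _ - _ = (laurent d g z - laurent d (h j) z) - (laurent d g z - laurent d (h j.+1) z)).
      apply: le_trans (ler_rnormB _ _) _; rewrite mulr_natl mulr2n.
      by apply: lerD (k1 z hz) (le_trans (k2 z hz) (Emono j)).
    by rewrite opprB [RHS]addrC addrA subrK.
  - by rewrite ler_wpM2r.
  by rewrite /b -/s le_eqVlt; apply/orP; left; apply/eqP; ring.
have s4 k : (k <= n)%N -> rnorm (diffop d (h k) x) <= \sum_(j < k) b j * E j * rnorm x.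
  elim: k => [_|k IH kn].
    rewrite big_ord0 diffop_const ?rnorm0// => i hi.
    by have [_ f1 _] := hh 0%N; have := f1 i hi; rewrite expn0 muln0.
  rewrite big_ord_recr /= -[diffop d (h k.+1) x](subrK (diffop d (h k) x)) addrC.
  apply: le_trans (ler_rnormD _ _) _; exact: lerD (s3 k kn) (IH (ltnW kn)).
have total : rnorm (\sum_(k < m.+1) sgnC k *: fcalc dot f (V k) x) <=
    2 ^+ m * (eta * rnorm x) + 2 ^+ m * (E n * rnorm x) + \sum_(j < n) b j * E j * rnorm x.
  set T := \sum_(k < m.+1) _ in s1 *.
  rewrite (_ : T = (T - diffop d g x) + (diffop d g x - diffop d (h n) x) + diffop d (h n) x).
    apply: le_trans (ler_rnormD _ _) _; apply: lerD; last exact: s4.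
    by apply: le_trans (ler_rnormD _ _) _; exact: lerD.
  by rewrite !addrA !subrK.
apply: le_trans total _.
have split (c : nat -> R) : \sum_(j < n) c j * E j * rnorm x =
    jackson_cst * lam * (\sum_(j < n) c j * w (2 ^- j)) * rnorm x +
    (\sum_(j < n) c j) * 2 ^+ m * rnorm x * eta.
  rewrite mulr_sumr !mulr_suml -big_split; apply: eq_bigr => j _.
  by rewrite /E /=; ring.
rewrite split -/b.
have -> : 2 ^+ m * (eta * rnorm x) + 2 ^+ m * (E n * rnorm x) +
    (jackson_cst * lam * (\sum_(j < n) b j * w (2 ^- j)) * rnorm x +
     (\sum_(j < n) b j) * 2 ^+ m * rnorm x * eta) =
    Q * eta + jackson_cst * lam * (2 ^+ m * w (2 ^- n) + \sum_(j < n) b j * w (2 ^- j)) * rnorm x.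
  by rewrite /Q /E; move: (\sum_(j < n) b j) (\sum_(j < n) _) => S1 S2; ring.
rewrite lerD2r /eta mulrA ler_pdivrMr// mulrC; apply: ler_wpM2l; first exact: ltW.
by rewrite lerDl.
Qed.

End Estimate.

(** * Dyadic sums and the final constants *)

Lemma adjoint_linear (R : realType) (H : completeNormedModType (Cplx R))
    (dot : {dot H for Num.conj}) (T : {linear H -> H}) (S : H -> H) :
  is_adjoint dot T S -> linear S.
Proof.
move=> TS k x y; apply: (dot_inj (dot := dot)) => z.
by rewrite -TS linearDr linearZr /= !TS linearDr linearZr.
Qed.

(** The sum is reversed by [i = n - 1 - j]. Then [2^-n <= a] gives [w (2^-j) <= w (2^(i+1) a)], and
    [a 2^n <= 2] gives [a 2^(j+1) <= 4 / 2^(i+1)], whence 80 as 20 times 4. The term [w (2^-n)] is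
    absorbed by [w a]. *)
Lemma dyadic_sum_le (R : realType) (m n : nat) (w : R -> R) (a : R) :
  (forall x, 0 < x -> 0 < w x) ->
  (forall x y, 0 < x -> x <= y -> w x <= w y) ->
  0 < a -> 2 ^- n <= a -> (0 < n)%N ==> (a * 2 ^+ n <= 2) ->
  2 ^+ m * w (2 ^- n) +
    \sum_(j < n) 2 * (20 * (a * (m.+1 * 2 ^ j.+1)%:R)) ^+ m * w (2 ^- j) <=
  (2 ^+ m + 2 * (80 * m.+1%:R) ^+ m) * \sum_(i < n.+1) w (2 ^+ i * a) / 2 ^+ (m * i).
Proof.
move=> w0 wm a0 na an; pose D : R := 2 * (80 * m.+1%:R) ^+ m.
have p2 k : 0 < 2 ^+ k :> R by rewrite exprn_gt0.
have D0 : 0 <= D by rewrite mulr_ge0// exprn_ge0// mulr_ge0.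
have t0 i : 0 <= w (2 ^+ i * a) / 2 ^+ (m * i).
  by rewrite divr_ge0 ?exprn_ge0// ltW// w0// mulr_gt0.
rewrite big_ord_recl expr0 mul1r muln0 expr0 divr1.
set S := \sum_(i < n) w _ / _.
have S0 : 0 <= S by apply: sumr_ge0 => i _.
have wa : w (2 ^- n) <= w a by apply: wm; rewrite ?invr_gt0.
have h1 : 2 ^+ m * w (2 ^- n) <= 2 ^+ m * w a by rewrite ler_wpM2l ?(ltW (p2 m)).
suff h2 : \sum_(j < n) 2 * (20 * (a * (m.+1 * 2 ^ j.+1)%:R)) ^+ m * w (2 ^- j) <= D * S.
  apply: le_trans (lerD h1 h2) _; rewrite -/D mulrDr !mulrDl.
  have h3 : 0 <= D * w a by rewrite mulr_ge0// ltW// w0.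
  have h4 : 0 <= 2 ^+ m * S by rewrite mulr_ge0// ltW.
  lra.
rewrite mulr_sumr (reindex_inj rev_ord_inj) /=; apply: ler_sum => i _.
have hi := ltn_ord i.
rewrite /bump leq0n add1n; set j := (n - i.+1)%N.
have nE : 2 ^+ n = 2 ^+ j * 2 ^+ i.+1 :> R by rewrite -exprD subnK.
have an2 : a * 2 ^+ n <= 2 by move: an; rewrite (leq_ltn_trans _ hi).
have wj : w (2 ^- j) <= w (2 ^+ i.+1 * a).
  apply: wm; first by rewrite invr_gt0.
  rewrite mulrC -ler_pdivrMr// -invfM mulrC; apply: le_trans na.
  by rewrite lef_pV2 ?posrE ?mulr_gt0// nE mulrC.
have aj : 20 * (a * (m.+1 * 2 ^ j.+1)%:R) <= 80 * m.+1%:R / 2 ^+ i.+1.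
  rewrite ler_pdivlMr// natrM natrX exprS.
  have -> : 20 * (a * (m.+1%:R * (2 * 2 ^+ j))) * 2 ^+ i.+1 = 40 * m.+1%:R * (a * 2 ^+ n).
    by rewrite nE; ring.
  have : 40 * m.+1%:R * (a * 2 ^+ n) <= 40 * m.+1%:R * 2.
    by rewrite ler_wpM2l// mulr_ge0.
  lra.
have -> : D * (w (2 ^+ i.+1 * a) / 2 ^+ (m * i.+1)) =
  2 * ((80 * m.+1%:R / 2 ^+ i.+1) ^+ m * w (2 ^+ i.+1 * a)).
  by rewrite /D mulnC exprM expr_div_n; ring.
rewrite -mulrA ler_wpM2l// ler_pM ?exprn_ge0 ?mulr_ge0 ?(ltW a0)//.
  by rewrite ltW// w0// invr_gt0.
by rewrite lerXn2r ?nnegrE ?divr_ge0 ?mulr_ge0 ?(ltW a0) ?(ltW (p2 _)).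
Qed.

(** The least [n] with [2^-n <= a]. If it is 0 then [a] may be arbitrarily large, hence the guard on
    the upper bound. *)
Lemma dyadic_scale (R : realType) (a : R) : 0 < a ->
  exists2 n : nat, 2 ^- n <= a & (0 < n)%N ==> (a * 2 ^+ n <= 2).
Proof.
move=> a0; have ex : exists n : nat, 2 ^- n <= a.
  exists (Num.Def.archi_bound a^-1); rewrite -[a]invrK lef_pV2 ?posrE ?invr_gt0 ?exprn_gt0//.
  by rewrite invrK; exact: ltW (upper_nthrootP (leqnn _)).
case: (ex_minnP ex) => -[|n] hn hmin; first by exists 0%N.
exists n.+1 => //=; rewrite exprS mulrCA -ler_pdivlMl// mulVf//.
have : a < 2 ^- n by rewrite ltNge; apply/negP => /hmin; rewrite ltnn.
by move=> /ltW; rewrite -[2 ^- n]div1r ler_pdivlMr ?exprn_gt0.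
Qed.

(** With [E = e^(a/2)], [e^(-a/2) >= 1 - a/2] gives [E (1 - a/2) <= 1]; for [a <= 1] this yields
    [E <= 2] and [E - 1 <= E a / 2 <= a]. *)
Lemma expR_half_le (R : realType) (a : R) : 0 <= a -> a <= 1 -> expR (a / 2) - 1 <= a.
Proof.
move=> a0 a1; have := expR_ge1Dx (- (a / 2)); rewrite expRN.
have e0 := expR_gt0 (a / 2); set E := expR _ in e0 *.
rewrite -(ler_pM2r e0) mulVf ?gt_eqF// => h.
nra.
Qed.

Unset Implicit Arguments.

Theorem theorem11p4 (R : realType) (m : nat) (m_gt0 : (0 < m)%N) :
  exists c : R, 0 < c /\
  forall w : R -> R,
    (forall x, 0 < x -> 0 < w x) ->
    (forall x y, 0 < x -> x <= y -> w x <= w y) ->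
    w x @[x --> 0^'+] --> 0 ->
    (forall x, 0 < x -> w (2 * x) <= 2 ^+ m * w x) ->
  forall f : Cplx R -> Cplx R, in_Lambda w m f ->
  forall (H : completeNormedModType (Cplx R)) (dot : {dot H for Num.conj}),
    (forall x : H, `|x| ^+ 2 = dot x x) ->
  forall U A : {linear H -> H},
    unitary dot U ->
    self_adjoint dot A -> (opnorm A < +oo)%E ->
    (opnorm (\sum_(k < m.+1) ((-1) ^+ k * 'C(m, k)%:R) *:
               fcalc dot f (expop ((k%:R * 'i) *: (A : H -> H)) \o U))%R
     <= c%:E * Lambda_norm w m f * omega_star w m (fine (opnorm A)))%E.
Proof.
pose C1 : R := jackson_cst R m * (2 ^+ m + 2 * (80 * m.+1%:R) ^+ m).
have C10 : 0 < C1.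
  apply: mulr_gt0.
    by rewrite mulr_gt0 ?exprn_gt0// ltr_pwDl// mulr_ge0// exprn_ge0.
  by rewrite ltr_pwDl ?exprn_gt0// mulr_ge0// exprn_ge0// mulr_ge0.
(* The factor [2^(m+1)] cancels the loss in [omega_star_ge]. *)
exists (C1 * 2 ^+ m.+1); split; first by rewrite mulr_gt0 ?exprn_gt0.
move=> w w0 wm _ wd f [fcont fL] H dot hdot U A [U'0 [U_adj UK U'K]] sA Afin.
pose U' : {linear H -> H} := HB.pack U'0 (GRing.isLinear.Build _ _ _ _ _ (adjoint_linear U_adj)).
have circle1 : circle (1 : Cplx R) by rewrite /circle /= normr1.
have [lam lam0 lamE] : exists2 lam : R, 0 <= lam & Lambda_norm w m f = lam%:E.
  have L0 : (0%:E <= Lambda_norm w m f)%E.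
    (* The pair [tau = -1], [zeta = 1] shows that the supremum is over a nonempty set, hence
       nonnegative. *)
    have N1 : (-1 : Cplx R) != 1 by rewrite -subr_eq0 -opprD oppr_eq0 (_ : 1 + 1 = 2%:R)// pnatr_eq0.
    apply: (@le_trans _ _ (rnorm (iter m (Delta (-1)) f 1) / w (rnorm (1 - (-1) : Cplx R)))%:E).
      rewrite lee_fin divr_ge0 ?rnorm_ge0// ltW// w0// lt_neqAle rnorm_ge0 eq_sym rnorm_eq0.
      by rewrite subr_eq0 eq_sym N1.
    apply: ereal_sup_ubound; exists (-1), 1; split => //.
    by rewrite /circle /= normrN normr1.
  exists (fine (Lambda_norm w m f)); first by rewrite fine_ge0.
  by rewrite fineK// ge0_fin_numE.
have f_lam t z : circle t -> t != 1 -> circle z ->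
    rnorm (iter m (Delta t) f z) <= lam * w (rnorm (1 - t)).
  move=> ht t1 hz.
  have wt : 0 < w (rnorm (1 - t)).
    by rewrite w0// lt_neqAle rnorm_ge0 eq_sym rnorm_eq0 subr_eq0 eq_sym t1.
  rewrite -ler_pdivrMr// -lee_fin -lamE; apply: ereal_sup_ubound.
  by exists t, z.
have [a a0 aE] : exists2 a : R, 0 <= a & opnorm A = a%:E.
  have A0 : (0%:E <= opnorm A)%E.
    apply: ereal_sup_ubound; exists 0; first by rewrite /= normr0.
    by rewrite linear0 rnorm0.
  exists (fine (opnorm A)); first by rewrite fine_ge0.
  by rewrite fineK// ge0_fin_numE.
have hA x : rnorm (A x) <= a * rnorm x.
  by apply: opnorm_bound; rewrite ?aE// => k y; rewrite linearZ.
rewrite lamE aE /=.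
have sgnE x : (\sum_(k < m.+1) ((-1) ^+ k * 'C(m, k)%:R) *:
    fcalc dot f (expop ((k%:R * 'i) *: (A : H -> H)) \o U))%R x =
  \sum_(k < m.+1) ((-1) ^+ k * 'C(m, k)%:R) *:
    fcalc dot f (expop ((k%:R * 'i) *: (A : H -> H)) \o U) x.
  by rewrite fct_sumE.
move: a0; rewrite le_eqVlt => /predU1P[a0|a0].
  (* For [A = 0] the right-hand side is 0; every [e^(ikA) U] is [U], and the alternating sum
     vanishes. *)
  rewrite /omega_star -a0 eqxx mule0; apply: opnorm_le => // x; rewrite sgnE.
  have VE k : expop ((k%:R * 'i) *: (A : H -> H)) \o U = U.
    apply/funext => y /=; apply/eqP; rewrite -subr_eq0 -rnorm_eq0 eq_le rnorm_ge0 andbT.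
    apply: le_trans (expop_near_id _ hA _ _) _; first by rewrite -a0.
    by rewrite -a0 mulr0 expR0 subrr mul0r.
  under eq_bigr do rewrite VE.
  by rewrite -scaler_suml sum_binomial_alt// scale0r rnorm0 mul0r.
(* Half of [t], so that the node [2k] of the central difference gives [k 'i]. *)
pose cW (t : R) : Cplx R := (t / 2)%:C%C * 'i.
pose W (t : R) : {linear H -> H} := HB.pack (expop (cW t *: (A : H -> H)))
  (GRing.isLinear.Build _ _ _ _ _ (expop_linear (ltW a0) hA (cW t))).
have WE t x : W t x = expop (cW t *: (A : H -> H)) x by [].
have WD t u x : W (t + u) x = W t (W u x).
  by rewrite !WE -(expopD (ltW a0) hA) /cW -mulrDl -rmorphD -mulrDl.
have W0 x : W 0 x = x.
  by rewrite WE /cW mul0r mul0r (expop0 (ltW a0) hA).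
have W_adj t : is_adjoint dot (W t) (W (- t)).
  have := expop_adjoint (ltW a0) hA (cW t) hdot sA.
  suff -> : (cW t)^*%R = cW (- t) by [].
  rewrite /cW rmorphM /= conjCi mulNr rmorphN mulrN mulNr; congr (- (_ * _)).
  by apply: conj_Creal; rewrite realE !lecR; exact: le_total.
pose e := expR (a / 2) - 1.
have e0 : 0 <= e by rewrite subr_ge0 -expR0 ler_expR divr_ge0// ltW.
have We x : rnorm (W 1 x - x) <= e * rnorm x.
  apply: le_trans (expop_near_id (ltW a0) hA _ _) _; rewrite /e.
  suff -> : rnorm (cW 1) = 2^-1 by rewrite [2^-1 * a]mulrC.
  rewrite /cW mul1r rnormM {2}/rnorm normCi mulr1.
  by rewrite /rnorm ger0_norm// lecR invr_ge0.
have f_dense : forall r : R, 0 < r -> exists d (p : {poly Cplx R}),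
    (size p <= (2 * d).+1)%N /\ forall z, circle z -> rnorm (f z - laurent d p z) <= r.
  have [M hM] := circle_bounded fcont.
  exact: trig_dense hM (@circle_unif _ _ fcont).
have [n na an] := dyadic_scale a0.
pose S := \sum_(i < n.+1) w (2 ^+ i * a) / 2 ^+ (m * i).
have S0 : 0 <= S.
  apply: sumr_ge0 => i _; rewrite divr_ge0 ?exprn_ge0// ltW// w0//.
  by rewrite mulr_gt0 ?exprn_gt0.
have main x : rnorm (\sum_(k < m.+1) ((-1) ^+ k * 'C(m, k)%:R : Cplx R) *:
    fcalc dot f (expop ((k%:R * 'i) *: (A : H -> H)) \o U) x) <= C1 * lam * S * rnorm x.
  have VE k : expop ((k%:R * 'i) *: (A : H -> H)) \o U = orbit_op W U (2 * k%:R).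
    apply/funext => y; rewrite -[orbit_op W U _ y]/(W (2 * k%:R) (U y)) WE /cW /=.
    congr (expop (_ *: _) _).
    by rewrite mulrAC mulfV// mul1r rmorph_nat.
  under eq_bigr do rewrite VE.
  (* For [n > 0], [a 2^n <= 2] forces [a <= 1], as [expR_half_le] requires. *)
  have hn : (0 < n)%N ==> (e <= a).
    apply/implyP => n0; apply: expR_half_le; first exact: ltW.
    move: an; rewrite n0 /= => an.
    have : a * 2 <= a * 2 ^+ n.
      by rewrite ler_wpM2l ?(ltW a0)// -(prednK n0) exprS ler_peMr// exprn_ege1// ler1n.
    by move=> /le_trans /(_ an); lra.
  have := main_estimate m_gt0 w0 wm wd lam0 f_lam f_dense hdot WD W0 W_adj
    (U' := U') U_adj UK U'K e0 We x a0 hn.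
  move=> /le_trans; apply; rewrite ler_wpM2r ?rnorm_ge0//.
  have := dyadic_sum_le m w0 wm a0 na an.
  move=> /(ler_wpM2l (mulr_ge0 (jackson_cst_ge0 R m) lam0)) /le_trans; apply.
  by rewrite le_eqVlt; apply/orP; left; apply/eqP; rewrite /C1 /S; ring.
apply: (@le_trans _ _ (C1 * lam * S)%:E).
  by apply: opnorm_le => [x|]; rewrite ?sgnE ?main// !mulr_ge0// ltW.
have hO := omega_star_ge m w0 wm n.+1 a0.
rewrite -EFinM; apply: le_trans (lee_wpmul2l _ hO); last first.
  by rewrite lee_fin !mulr_ge0 ?exprn_ge0// ltW.
rewrite -EFinM lee_fin -/S le_eqVlt; apply/orP; left; apply/eqP.
by field; rewrite expf_neq0.
Qed.
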